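(* Let $(R,\mathfrak{m})$ be a Cohen-Macaulay local ring of prime characteristic $p>0$ with $\dim R>0$, let $M$ be a finitely generated $R$-module, and let $s>0$ be a real number. Let $R\ltimes M$ be the idealization of $M$ and let $\mathfrak{m}\ltimes\mathfrak{m}M=\{(a,x): a\in\mathfrak{m},\ x\in\mathfrak{m}M\}$, an ideal of $R\ltimes M$. Then $$e_s(\mathfrak{m}\ltimes\mathfrak{m}M)\geq 1,$$ where the $s$-multiplicity is that of the ideal $\mathfrak{m}\ltimes\mathfrak{m}M$ of the local ring $R\ltimes M$.
   Context: All rings are commutative, Noetherian, local, with identity. Idealization: for a ring $R$ and an $R$-module $M$, $R\ltimes M$ is the set of pairs $(r,m)$, $r\in R$, $m\in M$, with componentwise addition and multiplication $(r,m)(r',m')=(rr',rm'+r'm)$. If $(R,\mathfrak{m})$ is local and $M$ is finitely generated, then $R\ltimes M$ is local with maximal ideal $\mathfrak{m}\ltimes M$, has the same characteristic as $R$, and $\dim(R\ltimes M)=\dim R$. $s$-multiplicity: let $(A,\mathfrak{n})$ be a local ring of prime characteristic $p>0$ and dimension $d>0$, let $I,J$ be $\mathfrak{n}$-primary ideals, $N$ a finitely generated $A$-module, $s>0$ real. Put $$h_s(I,J;N)=\lim_{e\to\infty}\frac{\ell_A\big(N/(I^{\lceil sp^e\rceil}+J^{[p^e]})N\big)}{p^{ed}},$$ where $\ell_A$ is length and $J^{[p^e]}$ is the ideal generated by the $p^e$-th powers of elements of $J$ (the limit is known to exist), and $$e_s(I,J;N)=\frac{h_s(I,J;N)}{\mathcal{H}_s(d)},\qquad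 \mathcal{H}_s(d)=\sum_{i=0}^{\lfloor s\rfloor}\frac{(-1)^i}{d!}\binom{d}{i}(s-i)^d .$$ For an $\mathfrak{n}$-primary ideal $I$ of $A$, $e_s(I):=e_s(I,I;A)$. *)

(* Defs.v *)
From HB Require Import structures.
From mathcomp Require Import all_boot all_order all_algebra.
From mathcomp Require Import all_classical all_reals all_analysis.

Set Implicit Arguments.
Unset Strict Implicit.
Unset Printing Implicit Defensive.

Import Order.TTheory GRing.Theory Num.Theory.
Import numFieldNormedType.Exports.

Local Open Scope classical_set_scope.
Local Open Scope ring_scope.

(* Equal to 0 (junk value) when P is empty or unbounded. *)
Definition nat_max (P : set nat) : nat :=
  xget 0%N [set n | P n /\ forall k, P k -> (k <= n)%N].

(* Lengths n of the chains c 0 < c 1 < ... < c n of sets satisfying P. *)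
Definition chain_length (T : Type) (P : set (set T)) : set nat :=
  [set n | exists c : nat -> set T,
     (forall i, (i <= n)%N -> P (c i)) /\
     (forall i, (i < n)%N -> c i `<` c i.+1)].

Section Submodules.
Variables (A : comNzRingType) (N : lmodType A).

Definition is_submod (L : set N) : Prop := submod_closed [in L].

Definition submod_span (S : set N) : set N := smallest is_submod S.

Definition finitely_generated (L : set N) : Prop :=
  exists x : seq N, submod_span [set` x] = L.

Definition submod_mul (I : set A) (L : set N) : set N :=
  submod_span [set a *: x | a in I & x in L].

(* The length of the module N/L: submodules of N/L correspond to submodules
   of N containing L. *)
Definition quot_length (K : realType) (L : set N) : \bar K :=
  ereal_sup [set n%:R%:E |
    n in chain_length [set L' | is_submod L' /\ L `<=` L']].

End Submodules.

Section Ideals.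
Variable A : comNzRingType.
Implicit Types I J P m : set A.

Definition is_ideal I : Prop := @is_submod A A^o I.

Definition ideal_span (S : set A) : set A := @submod_span A A^o S.

Definition ideal_exp I (n : nat) : set A :=
  iter n (@submod_mul A A^o I) setT.

(* The bracket power J^[q]. *)
Definition frobenius_power J (q : nat) : set A :=
  ideal_span [set x ^+ q | x in J].

Definition ideal_add I J : set A := [set a + b | a in I & b in J].

Definition is_prime_ideal P : Prop :=
  [/\ is_ideal P, ~ P 1 & prime_idealr_closed [in P]].

Definition is_maximal_ideal m : Prop :=
  [/\ is_ideal m, ~ m 1 &
      forall I, is_ideal I -> ~ I 1 -> m `<=` I -> I = m].

Definition is_local m : Prop :=
  is_maximal_ideal m /\ forall m', is_maximal_ideal m' -> m' = m.

Definition noetherian : Prop :=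
  forall I, is_ideal I -> @finitely_generated A A^o I.

Definition krull_dim : nat := nat_max (chain_length is_prime_ideal).

Definition regular_sequence (x : seq A) : Prop :=
  ~ ideal_span [set` x] 1 /\
  forall i, (i < size x)%N ->
  forall r, ideal_span [set` take i x] (x`_i * r) ->
            ideal_span [set` take i x] r.

(* The depth of A with respect to m. *)
Definition depth m : nat :=
  nat_max [set n | exists x : seq A,
    [/\ size x = n, forall a, a \in x -> m a & regular_sequence x]].

(* To be used for a Noetherian local ring A with maximal ideal m. *)
Definition cohen_macaulay m : Prop := depth m = krull_dim.

End Ideals.

Section SMultiplicity.
Variables (K : realType) (A : comNzRingType) (p : nat).

(* The ideal I^(ceil(s p^e)) + J^[p^e]; absz only casts int to nat, the ceiling
   being nonnegative for s > 0. *)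
Definition s_ideal (s : K) (I J : set A) (e : nat) : set A :=
  ideal_add (ideal_exp I (absz (Num.ceil (s * p%:R ^+ e))))
            (frobenius_power J (p ^ e)).

(* h = h_s(I, J; N), that is, the limit defining h_s(I, J; N) is h. *)
Definition is_h_s (s : K) (I J : set A) (N : lmodType A) (h : K) : Prop :=
  (fun e : nat =>
     quot_length K (submod_mul (s_ideal s I J e) [set: N])
     * ((p%:R ^+ (e * krull_dim A))^-1)%:E)%E @ \oo --> h%:E.

Definition H_s (s : K) (d : nat) : K :=
  \sum_(0 <= i < (Num.truncn s).+1)
     (-1) ^+ i / d`!%:R * 'C(d, i)%:R * (s - i%:R) ^+ d.

(* c = e_s(I, J; N). *)
Definition is_e_s (s : K) (I J : set A) (N : lmodType A) (c : K) : Prop :=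
  exists2 h, is_h_s s I J N h & c = h / H_s s (krull_dim A).

(* c = e_s(I). *)
Definition is_s_multiplicity (s : K) (I : set A) (c : K) : Prop :=
  is_e_s s I I A^o c.

End SMultiplicity.

Definition idealization (R : comNzRingType) (M : lmodType R) : Type :=
  (R * M)%type.

Section Idealization.
Variables (R : comNzRingType) (M : lmodType R).
Local Notation T := (idealization M).

HB.instance Definition _ := GRing.Zmodule.copy T (R * M)%type.

Definition idealization_one : T := (1, 0).
Definition idealization_mul (x y : T) : T :=
  (x.1 * y.1, x.1 *: y.2 + y.1 *: x.2).

Fact idealization_mulA : associative idealization_mul.
Proof.
move=> [a x] [b y] [c z]; rewrite /idealization_mul /= mulrA.
by rewrite !scalerDr !scalerA addrA (mulrC c a) (mulrC c b).
Qed.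

Fact idealization_mulC : commutative idealization_mul.
Proof.
by move=> [a x] [b y]; rewrite /idealization_mul /= mulrC addrC.
Qed.

Fact idealization_mul1r : left_id idealization_one idealization_mul.
Proof.
by move=> [a x]; rewrite /idealization_mul /= mul1r scale1r scaler0 addr0.
Qed.

Fact idealization_mulDl : left_distributive idealization_mul +%R.
Proof.
move=> [a x] [b y] [c z]; congr pair => /=; first by rewrite mulrDl.
by rewrite scalerDl scalerDr addrACA.
Qed.

Fact idealization_one_neq0 : idealization_one != 0.
Proof. by apply/eqP => -[/eqP]; rewrite oner_eq0. Qed.

HB.instance Definition _ := GRing.Zmodule_isComNzRing.Build T
  idealization_mulA idealization_mulC idealization_mul1r idealization_mulDl
  idealization_one_neq0.

(* The set I |x L of pairs (a, x) with a in I and x in L. *)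
Definition idealization_set (I : set R) (L : set M) : set T :=
  [set z | I z.1 /\ L z.2].

End Idealization.

(* Main.v *)
(* Projecting R |x M onto R maps the ideals defining e_s(m |x mM) into
   a_n = m^n + m^[q], where q = p^e and n = ceil(s q), and the two rings have
   the same dimension d. So it suffices to show that the length of R/a_n is at
   least the number of a in [0,q)^d with |a| < n - c, for some constant c: by
   inclusion-exclusion this number is asymptotic to H_s(d) q^d.

   If m has a reduction J generated by a regular sequence y_1, ..., y_d, then
   m^n is contained in J^(n-c), so R/(J^[q] + m^n) has length at least l(R/J)
   times that number, whereas a composition series of R/J shows that its length
   is at most l(R/J) l(R/a_n).

   A reduction with d generators is obtained as in Noether normalization, by
   eliminating generators of m with linear substitutions; this requires a large
   residue field, so R is first replaced by R[X]/(f), with f monic and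
   irreducible modulo m. Adding to each generator a high power of an element of
   a given regular sequence x_1, ..., x_d makes the reduction regular. *)

Require Import Defs.
From mathcomp Require Import all_boot all_order all_algebra.
From mathcomp Require Import all_classical all_reals all_analysis.
From mathcomp Require Import ring lra zify.

Set Implicit Arguments.
Unset Strict Implicit.
Unset Printing Implicit Defensive.

Import Order.TTheory GRing.Theory Num.Theory.
Import numFieldNormedType.Exports.

Local Open Scope classical_set_scope.
Local Open Scope ring_scope.

(** * Ideals and their lengths *)

(** Lengths are not numbers attached to quotient modules: a lower bound is a strict chain of ideals,
    an upper bound is a bound on all such chains. Both add along inclusions and pass to cyclic
    subquotients through colon ideals, so no quotient by an ideal of R has to be formed to measure
    it.

    Eliminating a generator rests on growth. With r generators there are w^r monomials with
    exponents below w, all of degree below r w, while the quotient by m^(r w) has length at most (r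
    w)^d L, where L bounds the length modulo x_1, ..., x_d. For r > d and w large this forces a
    homogeneous relation modulo the next power of m. Kronecker substitution turns it into a
    polynomial in one variable, nonzero modulo m, and a residue element that is not a root is
    needed. Therefore f is a factor of a polynomial whose roots have large order: the powers of X
    then supply enough distinct elements.

    The constant c is an exponent with m^(c+1) contained in J m^c over the extended ring. It does
    not depend on the power q of p, so it disappears in the limit. *)

Section Submodules.
Variables (A : comNzRingType) (V : lmodType A).
Implicit Types (L : set V) (S : set V).

Lemma is_submodP L :
  is_submod L <->
  L 0 /\ forall a u v, L u -> L v -> L (a *: u + v).
Proof.
split=> -[L0 LD]; split.
- by move: L0; rewrite inE.
- move=> a u v Lu Lv; have := LD a u v; rewrite !inE; exact.
- by rewrite inE.
- by move=> a u v; rewrite !inE => Lu Lv; apply: LD.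
Qed.

Lemma submod_span_is_submod S : is_submod (submod_span S).
Proof.
apply/is_submodP; split=> [|a u v Su Sv] L [Lsub SL].
  by have [] := (is_submodP _).1 Lsub.
have [_ LD] := (is_submodP _).1 Lsub.
by apply: LD; [apply: Su|apply: Sv].
Qed.

Lemma sub_submod_span S : S `<=` submod_span S.
Proof. exact: sub_smallest. Qed.

Lemma submod_span_min S L :
  is_submod L -> S `<=` L -> submod_span S `<=` L.
Proof. exact: smallest_sub. Qed.

End Submodules.

Section Ideals.
Variable A : comNzRingType.
Implicit Types (I J K P : set A) (a b x y z : A).

Lemma is_idealP I :
  is_ideal I <-> I 0 /\ forall a u v, I u -> I v -> I (a * u + v).
Proof. exact: (@is_submodP A A^o). Qed.

Section Closure.
Variables (I : set A) (hI : is_ideal I).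

Lemma ideal_0 : I 0. Proof. exact: ((is_idealP I).1 hI).1. Qed.

Lemma ideal_Ml a u : I u -> I (a * u).
Proof.
move=> Iu; have := ((is_idealP I).1 hI).2 a u 0 Iu ideal_0.
by rewrite addr0.
Qed.

Lemma ideal_Mr a u : I u -> I (u * a).
Proof. by rewrite mulrC; apply: ideal_Ml. Qed.

Lemma ideal_D u v : I u -> I v -> I (u + v).
Proof.
by move=> Iu Iv; have := ((is_idealP I).1 hI).2 1 u v Iu Iv; rewrite mul1r.
Qed.

Lemma ideal_N u : I u -> I (- u).
Proof. by move=> Iu; rewrite -mulN1r; apply: ideal_Ml. Qed.

Lemma ideal_B u v : I u -> I v -> I (u - v).
Proof. by move=> Iu Iv; apply: ideal_D => //; apply: ideal_N. Qed.

Lemma ideal_BC u v : I (u - v) -> I (v - u).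
Proof. by move=> h; rewrite -opprB; apply: ideal_N. Qed.

Lemma ideal_Dl u v : I (u + v) -> I v -> I u.
Proof. by move=> h1 h2; rewrite -(addrK v u); apply: ideal_B. Qed.

Lemma ideal_sum (T : Type) (r : seq T) (Q : pred T) (F : T -> A) :
  (forall i, Q i -> I (F i)) -> I (\sum_(i <- r | Q i) F i).
Proof.
by move=> h; apply: big_ind => //; [apply: ideal_0|move=> *; apply: ideal_D].
Qed.

Lemma ideal_1 : I 1 -> I = setT.
Proof.
by move=> I1; apply/seteqP; split=> // x _; rewrite -[x]mulr1; apply: ideal_Ml.
Qed.

End Closure.

Lemma ideal_setT : is_ideal (setT : set A).
Proof. by apply/is_idealP. Qed.

Lemma ideal_set0 : is_ideal ([set 0] : set A).
Proof. by apply/is_idealP; split => //= a u v -> ->; rewrite mulr0 addr0. Qed.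

Lemma ideal_setI I J : is_ideal I -> is_ideal J -> is_ideal (I `&` J).
Proof.
move=> hI hJ; apply/is_idealP; split; first by split; apply: ideal_0.
by move=> a u v [Iu Ju] [Iv Jv]; split; apply: ideal_D => //; apply: ideal_Ml.
Qed.

Lemma ideal_add_ideal I J :
  is_ideal I -> is_ideal J -> is_ideal (ideal_add I J).
Proof.
move=> hI hJ; apply/is_idealP; split.
  by exists 0; [apply: ideal_0|exists 0; [apply: ideal_0|rewrite addr0]].
move=> a _ _ [i1 I1 [j1 J1 <-]] [i2 I2 [j2 J2 <-]].
exists (a * i1 + i2); first by apply: ideal_D => //; apply: ideal_Ml.
exists (a * j1 + j2); first by apply: ideal_D => //; apply: ideal_Ml.
by ring.
Qed.

Lemma sub_ideal_addl I J : is_ideal J -> I `<=` ideal_add I J.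
Proof.
by move=> hJ x Ix; exists x => //; exists 0; [apply: ideal_0|rewrite addr0].
Qed.

Lemma sub_ideal_addr I J : is_ideal I -> J `<=` ideal_add I J.
Proof.
by move=> hJ x Ix; exists 0; [apply: ideal_0|exists x => //; rewrite add0r].
Qed.

Lemma ideal_add_min I J K :
  is_ideal K -> I `<=` K -> J `<=` K -> ideal_add I J `<=` K.
Proof.
move=> hK IK JK _ [i Ii [j Jj <-]].
by apply: ideal_D => //; [apply: IK|apply: JK].
Qed.

Lemma ideal_add_mono I J I' J' :
  I `<=` I' -> J `<=` J' -> ideal_add I J `<=` ideal_add I' J'.
Proof. by move=> II' JJ' _ [i /II' Ii [j /JJ' Jj <-]]; exists i => //; exists j. Qed.

Definition colon I z : set A := [set r | I (r * z)].

Lemma colon_ideal I z : is_ideal I -> is_ideal (colon I z).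
Proof.
move=> hI; apply/is_idealP; split; rewrite /colon /=.
  by rewrite mul0r; apply: ideal_0.
move=> a u v Iu Iv; rewrite mulrDl -mulrA.
by apply: ideal_D => //; apply: ideal_Ml.
Qed.

Definition adjoin I z : set A := [set x | exists a, I (x - a * z)].

Lemma adjoin_ideal I z : is_ideal I -> is_ideal (adjoin I z).
Proof.
move=> hI; apply/is_idealP; split.
  by exists 0; rewrite mul0r subr0; apply: ideal_0.
move=> a u v [b Ib] [c Ic]; exists (a * b + c).
have -> : a * u + v - (a * b + c) * z = a * (u - b * z) + (v - c * z) by ring.
by apply: ideal_D => //; apply: ideal_Ml.
Qed.

Lemma sub_adjoin I z : I `<=` adjoin I z.
Proof. by move=> x Ix; exists 0; rewrite mul0r subr0. Qed.

Lemma mem_adjoin I z : is_ideal I -> adjoin I z z.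
Proof. by move=> hI; exists 1; rewrite mul1r subrr; apply: ideal_0. Qed.

Lemma adjoin_min I z K : is_ideal K -> I `<=` K -> K z -> adjoin I z `<=` K.
Proof.
move=> hK IK Kz x [a /IK Ia]; rewrite -(subrK (a * z) x).
by apply: ideal_D => //; apply: ideal_Ml.
Qed.

Lemma adjoin_mono I J z : I `<=` J -> adjoin I z `<=` adjoin J z.
Proof. by move=> IJ x [a /IJ Ja]; exists a. Qed.

Lemma adjoin_id I z : is_ideal I -> I z -> adjoin I z = I.
Proof.
move=> hI Iz; apply/seteqP; split; last exact: sub_adjoin.
exact: adjoin_min.
Qed.

Lemma adjoinC I y z : adjoin (adjoin I y) z = adjoin (adjoin I z) y.
Proof.
by apply/seteqP; split=> x [a [b h]]; exists b, a; rewrite addrAC.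
Qed.

Definition adjoins I (zs : seq A) : set A := foldl adjoin I zs.

Lemma adjoins_rcons I zs z : adjoins I (rcons zs z) = adjoin (adjoins I zs) z.
Proof. by rewrite /adjoins -cats1 foldl_cat. Qed.

Lemma adjoins_cat I ys zs : adjoins I (ys ++ zs) = adjoins (adjoins I ys) zs.
Proof. exact: foldl_cat. Qed.

Lemma adjoins_ideal I zs : is_ideal I -> is_ideal (adjoins I zs).
Proof. by elim: zs I => //= z zs IH I hI; apply/IH/adjoin_ideal. Qed.

Lemma sub_adjoins I zs : I `<=` adjoins I zs.
Proof.
elim: zs I => [|z zs IH] I; first exact: subset_refl.
by apply: subset_trans (IH _); apply: sub_adjoin.
Qed.

Lemma mem_adjoins I zs z : is_ideal I -> z \in zs -> adjoins I zs z.
Proof.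
elim: zs I => [//|y zs IH] I hI /=; rewrite inE => /orP[/eqP ->|h].
  exact/sub_adjoins/mem_adjoin.
by apply: IH => //; apply: adjoin_ideal.
Qed.

Lemma adjoins_min I zs K : is_ideal K -> I `<=` K ->
  (forall z, z \in zs -> K z) -> adjoins I zs `<=` K.
Proof.
move=> hK; elim: zs I => [//|z zs IH] I IK h /=.
apply: IH => [|y hy]; last by apply: h; rewrite inE hy orbT.
by apply: adjoin_min => //; apply: h; rewrite mem_head.
Qed.

Lemma adjoins_mono I J zs : I `<=` J -> adjoins I zs `<=` adjoins J zs.
Proof. by elim: zs I J => //= z zs IH I J IJ; apply/IH/adjoin_mono. Qed.

Lemma adjoins_adjoin I zs z : adjoins (adjoin I z) zs = adjoin (adjoins I zs) z.
Proof. by elim: zs I => //= y zs IH I; rewrite -IH adjoinC. Qed.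

Lemma ideal_span_adjoins (zs : seq A) : ideal_span [set` zs] = adjoins [set 0] zs.
Proof.
have hI : is_ideal (adjoins [set 0] zs) by apply/adjoins_ideal/ideal_set0.
apply/seteqP; split.
  apply: (@submod_span_min A A^o) => // z /= hz.
  exact: mem_adjoins ideal_set0 hz.
have hS := @submod_span_is_submod A A^o [set` zs].
apply: adjoins_min => //.
  by move=> _ ->; apply: (@ideal_0 _ hS).
by move=> z hz; apply: (@sub_submod_span A A^o).
Qed.

Lemma noetherian_adjoins I : noetherian A -> is_ideal I ->
  exists zs : seq A, I = adjoins [set 0] zs.
Proof. by move=> nA /nA[zs <-]; exists zs; rewrite -ideal_span_adjoins. Qed.

Definition ideal_mul I J : set A := @submod_mul A A^o I J.

Lemma ideal_mul_ideal I J : is_ideal (ideal_mul I J).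
Proof. exact: (@submod_span_is_submod A A^o). Qed.

Lemma mem_ideal_mul I J a b : I a -> J b -> ideal_mul I J (a * b).
Proof.
by move=> Ia Jb; apply: (@sub_submod_span A A^o); exists a => //; exists b.
Qed.

Lemma ideal_mul_min I J K : is_ideal K ->
  (forall a b, I a -> J b -> K (a * b)) -> ideal_mul I J `<=` K.
Proof.
move=> hK h; apply: (@submod_span_min A A^o) => // _ [a Ia [b Jb <-]].
exact: h.
Qed.

Lemma ideal_mul_mono I J I' J' : I `<=` I' -> J `<=` J' -> ideal_mul I J `<=` ideal_mul I' J'.
Proof.
move=> II' JJ'; apply: ideal_mul_min; first exact: ideal_mul_ideal.
by move=> a b /II' Ia /JJ' Jb; apply: mem_ideal_mul.
Qed.

Lemma ideal_mul_subr I J : is_ideal J -> ideal_mul I J `<=` J.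
Proof. by move=> hJ; apply: ideal_mul_min => // a b _; apply: ideal_Ml. Qed.

Lemma ideal_mul_subl I J : is_ideal I -> ideal_mul I J `<=` I.
Proof. by move=> hJ; apply: ideal_mul_min => // a b ? _; apply: ideal_Mr. Qed.

Local Notation "I ^** n" := (ideal_exp I n) (at level 30).

Lemma ideal_exp_ideal I n : is_ideal (I ^** n).
Proof. by case: n => [|n]; [apply: ideal_setT|apply: ideal_mul_ideal]. Qed.

Lemma ideal_expS I n : I ^** n.+1 = ideal_mul I (I ^** n). Proof. by []. Qed.

Lemma ideal_exp_1 I x : I x -> (I ^** 1) x.
Proof. by move=> Ix; rewrite -[x]mulr1; apply: mem_ideal_mul. Qed.

Lemma ideal_exp_1sub I : is_ideal I -> I ^** 1 `<=` I.
Proof. by move=> hI; apply: ideal_mul_subl. Qed.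

Lemma ideal_exp_M I k l x y : (I ^** k) x -> (I ^** l) y -> (I ^** (k + l)) (x * y).
Proof.
move=> + Iy; elim: k x => [|k IH] x.
  by move=> _; apply: ideal_Ml (ideal_exp_ideal _ _) _ _ Iy.
apply: (@ideal_mul_min _ _ (colon (I ^** (k.+1 + l)) y)).
  exact/colon_ideal/ideal_exp_ideal.
by move=> u v Iu Iv; rewrite /colon /= -mulrA; apply: mem_ideal_mul => //; apply: IH.
Qed.

Lemma ideal_exp_X I x n : I x -> (I ^** n) (x ^+ n).
Proof.
move=> Ix; elim: n => // n IH; rewrite exprS; exact: mem_ideal_mul.
Qed.

Lemma ideal_exp_anti I k n : (k <= n)%N -> I ^** n `<=` I ^** k.
Proof.
elim: n => [|n IH]; first by rewrite leqn0 => /eqP ->.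
rewrite leq_eqVlt => /orP[/eqP -> //|]; rewrite ltnS => /IH.
by apply: subset_trans; apply: ideal_mul_subr; apply: ideal_exp_ideal.
Qed.

Lemma ideal_exp_sub I n : is_ideal I -> (0 < n)%N -> I ^** n `<=` I.
Proof. by move=> hI /ideal_exp_anti h; apply: subset_trans (h _) (ideal_exp_1sub hI). Qed.

Lemma ideal_exp_mono I J n : I `<=` J -> I ^** n `<=` J ^** n.
Proof. by move=> IJ; elim: n => // n IH; apply: ideal_mul_mono. Qed.

Lemma frobenius_ideal I q : is_ideal (frobenius_power I q).
Proof. exact: (@submod_span_is_submod A A^o). Qed.

Lemma frobenius_min I q K : is_ideal K ->
  (forall x, I x -> K (x ^+ q)) -> frobenius_power I q `<=` K.
Proof.
by move=> hK h; apply: (@submod_span_min A A^o) => // _ [x Ix <-]; apply: h.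
Qed.

Lemma mem_frobenius I q x : I x -> frobenius_power I q (x ^+ q).
Proof. by move=> Ix; apply: (@sub_submod_span A A^o); exists x. Qed.

Lemma frobenius_mono I J q : I `<=` J ->
  frobenius_power I q `<=` frobenius_power J q.
Proof.
move=> IJ; apply: frobenius_min; first exact: frobenius_ideal.
by move=> x /IJ; apply: mem_frobenius.
Qed.

End Ideals.

Notation "I ^** n" := (ideal_exp I n) (at level 30) : ring_scope.

(** * Length of a subquotient J/I through chains of ideals *)

Section Length.
Variable A : comNzRingType.
Implicit Types (I J K P : set A) (x y z : A).

(** Says that J/I has length at least n. The chain need not start at I or end at J, which makes
    monotonicity in I and J immediate. [length_le] is the matching upper bound. *)
Definition ideal_chain I J (n : nat) : Prop :=
  exists c : nat -> set A,
    (forall i, (i <= n)%N -> [/\ is_ideal (c i), I `<=` c i & c i `<=` J]) /\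
    (forall i, (i < n)%N -> c i `<` c i.+1).

Definition length_le I J (n : nat) : Prop := forall k, ideal_chain I J k -> (k <= n)%N.

Lemma ideal_chain_mono I J I' J' n : I' `<=` I -> J `<=` J' -> ideal_chain I J n -> ideal_chain I' J' n.
Proof.
move=> I'I JJ' [c [h1 h2]]; exists c; split=> [i /h1[h3 h4 h5]|//].
by split=> //; [apply: subset_trans h4|apply: subset_trans JJ'].
Qed.

Lemma length_le_mono I J I' J' n : I' `<=` I -> J `<=` J' ->
  length_le I' J' n -> length_le I J n.
Proof. by move=> h1 h2 h k /(ideal_chain_mono h1 h2)/h. Qed.

Lemma ideal_chain_leq I J n m : (m <= n)%N -> ideal_chain I J n -> ideal_chain I J m.
Proof.
move=> mn [c [h1 h2]]; exists c; split=> i im; first by apply/h1/(leq_trans im).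
exact/h2/(leq_trans im).
Qed.

Lemma ideal_chain0 I J : is_ideal I -> I `<=` J -> ideal_chain I J 0.
Proof. by move=> hI IJ; exists (fun _ => I); split=> [i _|i]; first split. Qed.

Lemma ideal_chain1 I J : is_ideal I -> is_ideal J -> I `<` J -> ideal_chain I J 1.
Proof.
move=> hI hJ IJ; have [sIJ _] := IJ.
exists (fun i => if i == 0%N then I else J); split; last by case.
by move=> [|i] _ /=; split=> //; apply: subset_refl.
Qed.

Lemma ideal_chain_sub I J n : ideal_chain I J n -> I `<=` J.
Proof. by move=> [c [h _]]; have [_ h1 h2] := h 0%N isT; apply: subset_trans h2. Qed.

Lemma ideal_chain_cat I J K m n : ideal_chain I J m -> ideal_chain J K n -> ideal_chain I K (m + n).
Proof.
move=> cIJ cJK; have IJ := ideal_chain_sub cIJ; have JK := ideal_chain_sub cJK.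
have [c [h1 h2]] := cIJ; have [d [h3 h4]] := cJK.
(* Index m already takes [d 0], which contains J and hence [c m]; the step from m - 1 to m is
   therefore strict. *)
exists (fun i => if (i < m)%N then c i else d (i - m)%N); split=> i hi.
  case: ltnP => im.
    have [a1 a2 a3] := h1 _ (ltnW im).
    by split=> //; apply: subset_trans JK.
  have [|a1 a2 a3] := h3 (i - m)%N; first by lia.
  by split=> //; apply: subset_trans a2.
case: ltnP => im; last first.
  have -> : (i.+1 < m)%N = false by lia.
  by rewrite subSn //; apply: h4; lia.
case: ltnP => im'; first exact: h2.
have -> : (i.+1 - m = 0)%N by lia.
have Em : m = i.+1 by lia.
have [_ _ a3] := h1 m (leqnn _).
have [_ a2 _] := h3 0%N isT.
have := h2 _ im; rewrite -Em => -[b1 b2]; split.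
  by apply: subset_trans b1 _; apply: subset_trans a2.
by move=> e; apply: b2; apply: subset_trans _ e; apply: subset_trans a2.
Qed.

Lemma ideal_modular I J K : is_ideal I -> is_ideal J -> is_ideal K ->
  I `<=` J -> J `&` K `<=` I `&` K -> ideal_add J K `<=` ideal_add I K -> J `<=` I.
Proof.
move=> hI hJ hK IJ h1 h2 x Jx.
have [i Ii [k Kk E]] := h2 x (sub_ideal_addl hK Jx).
have Jk : J k by rewrite -(addKr i k) E addrC; apply: ideal_B => //; apply: IJ.
by have [Ik _] := h1 k (conj Jk Kk); rewrite -E; apply: ideal_D.
Qed.

(** Additivity of length: intersecting the chain with J and adding J to it give chains below and
    above J, and by [ideal_modular] each strict step stays strict in at least one of them. *)
Lemma ideal_chain_split I J K n : is_ideal J -> is_ideal K -> I `<=` J -> J `<=` K ->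
  ideal_chain I K n -> exists a b, (a + b = n)%N /\ ideal_chain I J a /\ ideal_chain J K b.
Proof.
move=> hJ hK IJ JK [c [h1 h2]].
suff H k : (k <= n)%N -> exists a b, (a + b = k)%N /\
    ideal_chain I (c k `&` J) a /\ ideal_chain J (ideal_add (c k) J) b.
  have [a [b [Eab [ha hb]]]] := H n (leqnn _).
  exists a, b; split=> //; split; first by apply: ideal_chain_mono ha => // x [].
  have [_ _ h] := h1 n (leqnn n).
  by apply: ideal_chain_mono hb => //; apply: ideal_add_min.
have hI i : (i <= n)%N -> is_ideal (c i `&` J).
  by move=> /h1[h _ _]; apply: ideal_setI.
have hS i : (i <= n)%N -> is_ideal (ideal_add (c i) J).
  by move=> /h1[h _ _]; apply: ideal_add_ideal.
elim: k => [|k IH] kn.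
  exists 0%N, 0%N; split=> //; split.
    suff /ideal_chain_mono H : ideal_chain (c 0%N `&` J) (c 0%N `&` J) 0.
      by apply: H => // x Ix; split; [have [_ h _] := h1 _ kn; apply: h|apply: IJ].
    by apply: ideal_chain0; [apply: hI|apply: subset_refl].
  apply: ideal_chain0 => //; apply: sub_ideal_addr; by have [] := h1 _ kn.
have [a [b [Eab [ha hb]]]] := IH (ltnW kn).
have [hk _ _] := h1 _ (ltnW kn); have [hk1 _ _] := h1 _ kn.
have [s1 s2] := h2 _ kn.
have sI : c k `&` J `<=` c k.+1 `&` J by move=> x [/s1].
have sS : ideal_add (c k) J `<=` ideal_add (c k.+1) J by apply: ideal_add_mono.
have [e1|ne1] := pselect (c k.+1 `&` J `<=` c k `&` J); last first.
  exists a.+1, b; split; first by rewrite addSn Eab.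
  split; last exact: ideal_chain_mono hb.
  rewrite -[a.+1]addn1; apply: ideal_chain_cat ha _; apply: ideal_chain1 => //; [exact/hI/ltnW|exact: hI].
exists a, b.+1; split; first by rewrite addnS Eab.
split; first exact: ideal_chain_mono ha.
rewrite -[b.+1]addn1; apply: ideal_chain_cat hb _; apply: ideal_chain1 => //.
- exact/hS/ltnW.
- exact: hS.
- by split=> // e2; apply: s2; apply: (ideal_modular hk hk1 hJ).
Qed.

Lemma length_le_cat I J K m n : is_ideal J -> is_ideal K -> I `<=` J -> J `<=` K ->
  length_le I J m -> length_le J K n -> length_le I K (m + n).
Proof.
move=> hJ hK IJ JK l1 l2 k /(ideal_chain_split hJ hK IJ JK)[a [b [<- [/l1 h1 /l2 h2]]]].
exact: leq_add.
Qed.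

Lemma length_le0 I : length_le I I 0.
Proof.
move=> [//|k] [c [h1 h2]].
have [_ _ a] := h1 1%N isT; have [_ b _] := h1 0%N isT.
by have [_ []] := h2 0%N isT; apply: subset_trans b.
Qed.

(* The quotient (I + (z)) / I is isomorphic to A / (I : z). *)
Lemma ideal_chain_colon I z n : is_ideal I -> ideal_chain I (adjoin I z) n -> ideal_chain (colon I z) setT n.
Proof.
move=> hI [c [h1 h2]]; exists (fun i => colon (c i) z); split=> i hi.
  have [a1 a2 a3] := h1 _ hi; split=> //; first exact: colon_ideal.
  by move=> r /a2.
have [a1 a2 _] := h1 _ (ltnW hi); have [b1 b2 b3] := h1 _ hi.
have [s1 s2] := h2 _ hi; split; first by move=> r /s1.
move=> h; apply: s2 => x cx; have [a Ia] := b3 _ cx.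
rewrite -(subrK (a * z) x); apply: ideal_D => //; first exact: a2.
apply: h; rewrite /colon /= -(subKr x (a * z)).
by apply: ideal_B => //; apply: b2.
Qed.

Lemma ideal_chain_adjoin I J z n : is_ideal I -> (forall r, J r -> I (r * z)) ->
  ideal_chain I (adjoin I z) n -> ideal_chain J setT n.
Proof. by move=> hI h /(ideal_chain_colon hI); apply: ideal_chain_mono. Qed.

(** Each new generator spans a cyclic module killed by J, that is, a quotient of A/J. *)
Lemma length_le_adjoins I J zs l : is_ideal I -> length_le J setT l ->
  (forall r z, J r -> z \in zs -> I (r * z)) ->
  length_le I (adjoins I zs) (size zs * l).
Proof.
move=> + hl; elim: zs I => [|z zs IH] I hI h; first exact: length_le0.
rewrite /= mulSn; apply: (@length_le_cat _ (adjoin I z)).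
- exact: adjoin_ideal.
- exact/adjoins_ideal/adjoin_ideal.
- exact: sub_adjoin.
- exact: sub_adjoins.
- move=> k /(@ideal_chain_adjoin _ J) H; apply/hl/H => //.
  by move=> r Jr; apply: h => //; rewrite mem_head.
- apply: IH; first exact: adjoin_ideal.
  by move=> r y Jr hy; apply: sub_adjoin; apply: h => //; rewrite inE hy orbT.
Qed.

Lemma ideal_chain_adjoins I zs : is_ideal I ->
  (forall i, (i < size zs)%N -> ~ adjoins I (take i zs) zs`_i) ->
  ideal_chain I (adjoins I zs) (size zs).
Proof.
elim: zs I => [|z zs IH] I hI h; first exact: ideal_chain0.
rewrite [size _]/= -add1n /=; apply: (@ideal_chain_cat _ (adjoin I z)).
  apply: ideal_chain1 => //; first exact: adjoin_ideal.
  split; first exact: sub_adjoin.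
  move=> e; apply: (h 0%N isT); rewrite take0 /=; exact/e/mem_adjoin.
by apply: IH => [|i hi]; [apply: adjoin_ideal|apply: (h i.+1)].
Qed.

Lemma exact_length I J n : is_ideal I -> I `<=` J -> length_le I J n ->
  exists2 l, ideal_chain I J l & length_le I J l.
Proof.
move=> hI IJ h.
have ex : exists k, `[< ideal_chain I J k >] by exists 0%N; apply/asboolP/ideal_chain0.
have ub k : `[< ideal_chain I J k >] -> (k <= n)%N by move=> /asboolP/h.
have [l /asboolP hl ml] := ex_maxnP ex ub; exists l => // k hk.
exact/ml/asboolP.
Qed.

End Length.

(** * Ideals that contain a power of the maximal ideal *)

Section LocalIdeals.
Variables (A : comNzRingType) (m : set A).
Hypotheses (m_ideal : is_ideal m) (m_proper : ~ m 1).
Hypothesis m_unit : forall a, ~ m a -> exists b, a * b = 1.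
Implicit Types (I J K : set A).

Lemma length_le_max : length_le m setT 1.
Proof.
move=> [//|[//|k]] [c [h1 h2]].
have [h10 m0 _] := h1 0%N isT; have [h11 _ _] := h1 1%N isT.
have [_ n1] := h2 0%N isT; have [_ n2] := h2 1%N isT.
have [a ca nca] : exists2 a, c 1%N a & ~ c 0%N a.
  apply: contrapT => h; apply: n1 => a ca.
  by apply: contrapT => nca; apply: h; exists a.
have [b ab] : exists b, a * b = 1 by apply: m_unit => /m0.
have /(ideal_1 h11) E : c 1%N 1 by rewrite -ab; apply: ideal_Mr.
by case: n2; rewrite E.
Qed.

Lemma sub_max I : is_ideal I -> ~ I 1 -> I `<=` m.
Proof.
move=> hI nI x Ix; apply: contrapT => /m_unit[b E]; apply: nI.
by rewrite -E; apply: ideal_Mr.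
Qed.

(** Take the last power of m that is not contained in I: m multiplies any of its elements outside I
    into I. *)
Lemma socle I N : is_ideal I -> m ^** N `<=` I -> ~ I 1 ->
  exists2 z, ~ I z & forall r, m r -> I (r * z).
Proof.
move=> hI + nI; elim: N => [h|N IH h]; first by case: nI; apply: h.
have [/IH //|h2] := pselect (m ^** N `<=` I).
have [z mz nz] : exists2 z, (m ^** N) z & ~ I z.
  apply: contrapT => h3; apply: h2 => z mz; apply: contrapT => nz.
  by apply: h3; exists z.
by exists z => // r mr; apply: h; apply: mem_ideal_mul.
Qed.

(** Induction along a composition series of A/I with all factors A/m: the step adjoins a socle
    element to I, which shortens A/I. *)
Lemma primary_ind (P : set A -> Prop) N B :
  length_le (m ^** N) setT B -> P setT ->
  (forall I z, is_ideal I -> m ^** N `<=` I -> ~ I z ->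
     (forall r, m r -> I (r * z)) -> P (adjoin I z) -> P I) ->
  forall I, is_ideal I -> m ^** N `<=` I -> P I.
Proof.
move=> hB PT PS I hI mI.
have : length_le I setT B by apply: length_le_mono hB.
elim: {hB} B I hI mI => [|B IH] I hI mI lI.
  have [I1|nI1] := pselect (I 1); first by rewrite (ideal_1 hI I1).
  suff /lI : ideal_chain I setT 1 by [].
  by apply: ideal_chain1; [|apply: ideal_setT|split=> // h; apply: nI1; apply: h].
have [I1|nI1] := pselect (I 1); first by rewrite (ideal_1 hI I1).
have [z nz mz] := socle hI mI nI1.
apply: (PS _ z) => //; apply: IH.
- exact: adjoin_ideal.
- exact: subset_trans (@sub_adjoin _ _ _).
move=> k ck; suff /ideal_chain_cat/(_ ck)/lI : ideal_chain I (adjoin I z) 1 by [].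
apply: ideal_chain1; [by []|exact: adjoin_ideal|split; first exact: sub_adjoin].
by move=> h; apply: nz; apply: h; apply: mem_adjoin.
Qed.

(** m^n/m^(n+1) is spanned by finitely many elements killed by m, so its length is at most their
    number. *)
Lemma length_le_exp n : noetherian A -> exists B, length_le (m ^** n) setT B.
Proof.
move=> nA; elim: n => [|n [B hB]]; first by exists 0%N; apply: length_le0.
have [zs E] := noetherian_adjoins nA (ideal_exp_ideal m n).
have hz z : z \in zs -> (m ^** n) z.
  by move=> h; rewrite E; apply: mem_adjoins h; apply: ideal_set0.
have En : m ^** n = adjoins (m ^** n.+1) zs.
  apply/seteqP; split.
    rewrite {1}E; apply: adjoins_mono => _ ->; apply: ideal_0; exact: ideal_exp_ideal.
  apply: adjoins_min => //; [exact: ideal_exp_ideal|exact: ideal_exp_anti].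
exists (size zs * 1 + B)%N; apply: length_le_cat hB.
- exact: ideal_exp_ideal.
- exact: ideal_setT.
- exact: ideal_exp_anti.
- by [].
rewrite En; apply: length_le_adjoins length_le_max _; first exact: ideal_exp_ideal.
by move=> r z mr /hz; apply: mem_ideal_mul.
Qed.

End LocalIdeals.

(** * Nakayama's lemma and the ascending chain condition *)

Section Nakayama.
Variables (A : comNzRingType) (m : set A).
Hypotheses (m_ideal : is_ideal m) (m_proper : ~ m 1).
Hypothesis m_unit : forall a, ~ m a -> exists b, a * b = 1.

Lemma unit_1B a : m a -> exists b, (1 - a) * b = 1.
Proof.
move=> ma; apply: m_unit => m1; apply: m_proper.
by rewrite -(subrK a 1); apply: ideal_D.
Qed.

Definition mspan (V : lmodType A) (s : seq V) : set V :=
  [set v | exists2 c : nat -> A, forall j, m (c j) &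
     v = \sum_(j < size s) c j *: s`_j].

(** Since 1 - [c 0] is a unit, the first generator can be expressed through the others modulo I and
    removed. General modules are allowed because the lemma is also applied to R[X] over R. *)
Lemma nakayama_mod (V : lmodType A) (I : set V) (s : seq V) :
  is_submod I ->
  (forall v, v \in s -> exists2 w, mspan s w & I (v - w)) ->
  forall v, v \in s -> I v.
Proof.
move=> /is_submodP[I0 ID].
have IB u v : I u -> I v -> I (u + v).
  by move=> Iu Iv; rewrite -[u]scale1r; apply: ID.
have IZ a u : I u -> I (a *: u).
  by move=> Iu; rewrite -[_ *: _]addr0; apply: ID.
elim: s => // z s IH h.
have [w [c mc ->]] := h z (mem_head _ _).
rewrite big_ord_recl /= => Iz.
have [b hb] := unit_1B (mc 0%N).
have Iz' : I (z - \sum_(j < size s) (b * c j.+1) *: s`_j).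
  have -> : z - \sum_(j < size s) (b * c j.+1) *: s`_j =
     b *: (z - (c 0%N *: z + \sum_(j < size s) c (bump 0 j) *: s`_j)).
    have -> U : z - (c 0%N *: z + U) = (1 - c 0%N) *: z - U.
      by rewrite scalerBl scale1r opprD addrA.
    rewrite scalerBr scalerA mulrC hb scale1r; congr (_ - _).
    by rewrite scaler_sumr; apply: eq_bigr => j _; rewrite scalerA.
  exact: IZ.
have Is : forall v, v \in s -> I v.
  apply: IH => v vs; have [|w' [c' mc' ->]] := h v; first by rewrite inE vs orbT.
  rewrite big_ord_recl /= => Iv.
  exists (\sum_(j < size s) (c' 0%N * (b * c j.+1) + c' j.+1) *: s`_j).
    exists (fun j => c' 0%N * (b * c j.+1) + c' j.+1) => // j.
    by apply: ideal_D => //; apply: ideal_Mr.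
  have := IB _ _ Iv (IZ (c' 0%N) _ Iz'); congr I.
  rewrite scalerBr -addrA; congr (_ + _).
  rewrite addrC opprD addrACA subrr add0r -opprD scaler_sumr -big_split /=.
  by congr (- _); apply: eq_bigr => j _; rewrite scalerDl scalerA.
move=> v; rewrite inE => /orP[/eqP ->|/Is //].
rewrite -(subrK (\sum_(j < size s) (b * c j.+1) *: s`_j) z); apply: (IB) => //.
by apply: big_ind => [||j _]; [|exact: IB|apply: IZ; apply: Is; apply: mem_nth].
Qed.

Lemma nakayama (I Z : set A) : noetherian A -> is_ideal I -> is_ideal Z ->
  Z `<=` ideal_add I (ideal_mul m Z) -> Z `<=` I.
Proof.
move=> nA hI hZ; have [zs ->] := noetherian_adjoins nA hZ => h.
have hms : is_ideal (mspan (zs : seq A^o)).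
  apply/is_idealP; split.
    exists (fun _ => 0); first by move=> _; apply: ideal_0.
    by rewrite big1 // => j _; rewrite scale0r.
  move=> a _ _ [c mc ->] [d md ->]; exists (fun j => a * c j + d j).
    by move=> j; apply: ideal_D => //; apply: ideal_Ml.
  rewrite mulr_sumr -big_split /=; apply: eq_bigr => j _.
  by rewrite scalerDl -scalerA.
have sub : ideal_mul m (adjoins [set 0] zs) `<=` mspan (zs : seq A^o).
  apply: ideal_mul_min => // a b ma.
  have hK : is_ideal [set b | mspan (zs : seq A^o) (a * b)].
    apply/is_idealP; split=> /=; first by rewrite mulr0; apply: ideal_0.
    move=> e u v hu hv; rewrite mulrDr mulrCA.
    by apply: ideal_D => //; apply: ideal_Ml.
  apply: (adjoins_min hK) => [_ ->|z hz]; first exact: (ideal_0 hK).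
  exists (fun j => if j == index z zs then a else 0).
    by move=> j; case: eqP => // _; apply: ideal_0.
  have iz : (index z zs < size zs)%N by rewrite index_mem.
  rewrite (bigD1 (Ordinal iz)) //= eqxx nth_index // big1 ?addr0 // => j nj.
  by rewrite -val_eqE /= in nj; rewrite (negbTE nj) scale0r.
apply: adjoins_min => //; first by move=> _ ->; apply: ideal_0.
apply: (@nakayama_mod A^o) => // z hz.
have [i Ii [w /sub mw E]] := h z (mem_adjoins (ideal_set0 A) hz).
by exists w => //; rewrite -E addrK.
Qed.


Lemma acc (c : nat -> set A) : noetherian A -> (forall n, is_ideal (c n)) ->
  (forall n, c n `<=` c n.+1) -> exists N, c N.+1 `<=` c N.
Proof.
move=> nA hc inc.
have mono i j : (i <= j)%N -> c i `<=` c j.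
  elim: j => [|j IH]; first by rewrite leqn0 => /eqP ->.
  rewrite leq_eqVlt => /orP[/eqP -> //|]; rewrite ltnS => /IH h.
  exact: subset_trans (inc j).
have hU : is_ideal (\bigcup_n c n).
  apply/is_idealP; split; first by exists 0%N => //; apply: ideal_0.
  move=> a u v [i _ ciu] [j _ cjv]; exists (maxn i j) => //.
  apply: ideal_D; [exact: hc|apply: ideal_Ml; first exact: hc|].
    by apply: mono ciu; apply: leq_maxl.
  by apply: mono cjv; apply: leq_maxr.
have [zs E] := noetherian_adjoins nA hU.
suff [N hN] : exists N, forall z, z \in zs -> c N z.
  exists N => x cx; have : (\bigcup_n c n) x by exists N.+1.
  rewrite E; apply: adjoins_min => // _ ->; exact: ideal_0.
have : forall z, z \in zs -> (\bigcup_n c n) z.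
  by move=> z hz; rewrite E; apply: mem_adjoins => //; apply: ideal_set0.
elim: zs {E} => [|z zs IH] h; first by exists 0%N.
have [|N hN] := IH; first by move=> y hy; apply: h; rewrite inE hy orbT.
have [i _ ci] := h z (mem_head _ _).
exists (maxn i N) => y; rewrite inE => /orP[/eqP ->|/hN cy].
  by apply: mono ci; apply: leq_maxl.
by apply: mono cy; apply: leq_maxr.
Qed.

End Nakayama.

(** * Regular sequences *)

Section RegularSequences.
Variables (A : comNzRingType).
Implicit Types (I J : set A) (x y z : A) (xs ys : seq A).

Definition nonzerodivisor I x : Prop := forall r, I (x * r) -> I r.

Fixpoint regular_mod I xs : Prop :=
  if xs is x :: xs' then nonzerodivisor I x /\ regular_mod (adjoin I x) xs' else True.

Lemma regular_mod_cat I xs ys : regular_mod I (xs ++ ys) <-> regular_mod I xs /\ regular_mod (adjoins I xs) ys.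
Proof.
elim: xs I => [|x xs IH] I /=; first by split=> // -[].
by split=> [[h /IH[]]|[[h1 h2] h3]]; [|split=> //; apply/IH].
Qed.

Lemma regular_mod_rcons I xs x : regular_mod I (rcons xs x) <-> regular_mod I xs /\ nonzerodivisor (adjoins I xs) x.
Proof.
rewrite -cats1; split=> [/regular_mod_cat[h1 [h2 _]]|[h1 h2]]; first by [].
exact/regular_mod_cat.
Qed.

Lemma nonzerodivisor_1 I : nonzerodivisor I 1. Proof. by move=> r; rewrite mul1r. Qed.

Lemma nonzerodivisor_M I x y : nonzerodivisor I x -> nonzerodivisor I y -> nonzerodivisor I (x * y).
Proof. by move=> hx hy r; rewrite -mulrA => /hx/hy. Qed.

Lemma nonzerodivisor_X I x n : nonzerodivisor I x -> nonzerodivisor I (x ^+ n).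
Proof.
move=> hx; elim: n => [|n IH]; first exact: nonzerodivisor_1.
by rewrite exprS; apply: nonzerodivisor_M.
Qed.

Lemma nonzerodivisor_unit I x b : is_ideal I -> x * b = 1 -> nonzerodivisor I x.
Proof.
by move=> hI E r h; rewrite -[r]mul1r -E mulrAC; apply: ideal_Mr.
Qed.

Lemma regular_sequence_regular_mod xs : regular_sequence xs -> regular_mod [set 0] xs.
Proof.
move=> [_ h]; suff H k : (k <= size xs)%N -> regular_mod [set 0] (take k xs).
  by have := H _ (leqnn _); rewrite take_size.
elim: k => [|k IH] hk; first by rewrite take0.
rewrite (take_nth 0) //; apply/regular_mod_rcons; split; first exact/IH/ltnW.
by move=> r; rewrite -ideal_span_adjoins; apply: h.
Qed.

Section Powers.
Variables (I : set A) (x : A).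
Hypotheses (hI : is_ideal I).

(** Multiplication by x^q identifies A/(I + (x)) with (I + (x^q))/(I + (x^(q+1))), so every power of
    x contributes L steps. *)
Lemma ideal_chain_adjoin_X L q : nonzerodivisor I x -> ideal_chain (adjoin I x) setT L ->
  ideal_chain (adjoin I (x ^+ q)) setT (q * L).
Proof.
move=> hx [c [h1 h2]]; elim: q => [|q IH].
  by apply: ideal_chain0 => //; apply: adjoin_ideal.
rewrite mulSn; apply: ideal_chain_cat IH.
(* The ideals I + x^q [c i]; they increase strictly because x^q cancels modulo I. *)
exists (fun i => [set v | exists2 r, c i r & I (v - r * x ^+ q)]).
have hxq := @nonzerodivisor_X I x q hx.
split=> i hi.
  have [hc xc _] := h1 _ hi; split.
  - apply/is_idealP; split.
      by exists 0; [apply: ideal_0|rewrite mul0r subr0; apply: ideal_0].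
    move=> a u v [r cr Ir] [s cs Is]; exists (a * r + s).
      by apply: ideal_D => //; apply: ideal_Ml.
    have -> : a * u + v - (a * r + s) * x ^+ q =
      a * (u - r * x ^+ q) + (v - s * x ^+ q) by ring.
    by apply: ideal_D => //; apply: ideal_Ml.
  - move=> v [a]; rewrite exprS mulrA => Ia; exists (a * x) => //.
    by apply: xc; apply/(ideal_Ml (adjoin_ideal x hI))/mem_adjoin.
  - by move=> v [r _ Ir]; exists r.
have [hc0 xc0 _] := h1 _ (ltnW hi).
have [s1 s2] := h2 _ hi; split; first by move=> v [r /s1 cr Ir]; exists r.
move=> h; apply: s2 => r cr.
have [|s cs] := h (r * x ^+ q); first by exists r; rewrite // subrr; apply: ideal_0.
rewrite -mulrBl mulrC => /hxq/(@sub_adjoin _ _ x)/xc0 h3.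
by rewrite -(subrK s r); apply: ideal_D.
Qed.

(** For any x, multiplication by x^q still maps A/(I + (x)) onto that quotient, which gives the
    upper bound. *)
Lemma length_le_adjoin_X L q : length_le (adjoin I x) setT L ->
  length_le (adjoin I (x ^+ q)) setT (q * L).
Proof.
move=> hL; elim: q => [|q IH].
  suff -> : adjoin I (x ^+ 0) = setT by apply: length_le0.
  by apply: ideal_1; [apply: adjoin_ideal|apply: mem_adjoin].
have hi n : is_ideal (adjoin I (x ^+ n)) by apply: adjoin_ideal.
have E : adjoin I (x ^+ q) = adjoin (adjoin I (x ^+ q.+1)) (x ^+ q).
  rewrite adjoinC (@adjoin_id _ (adjoin I (x ^+ q))) // exprS.
  by apply: ideal_Ml => //; apply: mem_adjoin.
rewrite mulSn; apply: (@length_le_cat _ _ (adjoin I (x ^+ q))) => //.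
- exact: ideal_setT.
- by rewrite E; apply: sub_adjoin.
rewrite E => k /(@ideal_chain_adjoin _ _ (adjoin I x)) H; apply/hL/H => //.
by move=> r [a Ia]; exists a; rewrite exprS mulrA -mulrBl; apply: ideal_Mr.
Qed.

End Powers.

Lemma length_le_adjoins_X I xs L q : is_ideal I -> length_le (adjoins I xs) setT L ->
  length_le (adjoins I [seq x ^+ q | x <- xs]) setT (q ^ size xs * L).
Proof.
move=> + h; elim: xs I L h => [|x xs IH] I L h hI; first by rewrite mul1n.
rewrite /= expnSr -mulnA; apply: IH; last exact: adjoin_ideal.
rewrite adjoins_adjoin; apply: length_le_adjoin_X; first exact: adjoins_ideal.
by rewrite -adjoins_adjoin.
Qed.

Section Local.
Variable m : set A.
Hypotheses (m_ideal : is_ideal m) (m_proper : ~ m 1).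
Hypothesis m_unit : forall a, ~ m a -> exists b, a * b = 1.
Hypothesis nA : noetherian A.

(** If r y lies in I, then r = c x modulo I, and cancelling x puts c y in I. So (I : y) is contained
    in I + m (I : y), and Nakayama applies. *)
Lemma nonzerodivisor_swap I x y : is_ideal I -> m x -> nonzerodivisor I x -> nonzerodivisor (adjoin I x) y ->
  nonzerodivisor I y /\ nonzerodivisor (adjoin I y) x.
Proof.
move=> hI mx hx hy; split.
  have : colon I y `<=` I.
    apply: (nakayama m_ideal m_proper m_unit nA hI (colon_ideal y hI)).
    move=> r Ir; have [|c Ic] := hy r; first by apply: sub_adjoin; rewrite mulrC.
    exists (r - c * x) => //; exists (x * c); last by rewrite mulrC subrK.
    apply: mem_ideal_mul => //; apply: hx.
    have -> : x * (c * y) = r * y - (r - c * x) * y by ring.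
    by apply: ideal_B => //; apply: ideal_Mr.
  by move=> h r Ir; apply: h; rewrite /colon /= mulrC.
move=> r [c Ic].
have [e Ie] : adjoin I x c.
  by apply: hy; exists r; rewrite mulrC [r * x]mulrC; apply: ideal_BC.
exists e; apply: hx.
have -> : x * (r - e * y) = x * r - c * y + (c - e * x) * y by ring.
by apply: ideal_D => //; apply: ideal_Mr.
Qed.

Lemma regular_mod_front I xs ys x : is_ideal I -> (forall z, z \in xs -> m z) ->
  regular_mod I (xs ++ x :: ys) -> regular_mod I (x :: xs ++ ys).
Proof.
elim: xs I => [//|y xs IH] I hI mxs [hy h].
have mxs' z : z \in xs -> m z by move=> hz; apply: mxs; rewrite inE hz orbT.
have [hx h2] := IH _ (adjoin_ideal y hI) mxs' h.
have [h3 h4] := nonzerodivisor_swap hI (mxs _ (mem_head _ _)) hy hx.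
by split=> //=; split=> //; rewrite adjoinC.
Qed.

Lemma regular_mod_perm I xs ys : is_ideal I -> (forall z, z \in xs -> m z) ->
  perm_eq ys xs -> regular_mod I xs -> regular_mod I ys.
Proof.
elim: ys xs I => [//|y ys IH] xs I hI mxs h.
have : y \in xs by rewrite -(perm_mem h) mem_head.
move=> yxs hr; have [s1 [s2 E]] : exists s1 s2, xs = s1 ++ y :: s2.
  by case/splitPr: yxs => s1 s2; exists s1, s2.
rewrite {}E in h mxs hr {yxs}.
have h2 : perm_eq ys (s1 ++ s2).
  by rewrite -(perm_cons y) (permPl h) -[y :: s2]cat1s perm_catCA.
have ms z : z \in s1 ++ s2 -> m z.
  by rewrite mem_cat => hz; apply: mxs; rewrite mem_cat inE orbCA hz orbT.
have [|hy hr'] := regular_mod_front hI _ hr.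
  by move=> z hz; apply: ms; rewrite mem_cat hz.
by split=> //; apply: (IH (s1 ++ s2)) => //; apply: adjoin_ideal.
Qed.

Lemma regular_mod_move I xs x : is_ideal I -> (forall z, z \in xs -> m z) -> m x ->
  regular_mod I (x :: xs) <-> regular_mod I (rcons xs x).
Proof.
move=> hI mxs mx; split; apply: regular_mod_perm => //.
- by move=> z; rewrite inE => /orP[/eqP ->|/mxs].
- by rewrite perm_rcons.
- by move=> z; rewrite mem_rcons inE => /orP[/eqP ->|/mxs].
- by rewrite perm_sym perm_rcons.
Qed.

(** The sequence may be permuted, so its head is moved to the end, exchanged there for y, and y is
    moved back. *)
Lemma regular_mod_last I xs x y : is_ideal I -> (forall z, z \in xs -> m z) ->
  m x -> m y -> regular_mod I (x :: xs) -> nonzerodivisor (adjoins I xs) y -> regular_mod I (y :: xs).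
Proof.
move=> hI mxs mx my /(regular_mod_move hI mxs mx)/regular_mod_rcons[h1 _] h2.
exact/(regular_mod_move hI mxs my)/regular_mod_rcons.
Qed.

Lemma regular_mod_nonzerodivisor_last I xs x : is_ideal I -> (forall z, z \in xs -> m z) ->
  m x -> regular_mod I (x :: xs) -> nonzerodivisor (adjoins I xs) x.
Proof. by move=> hI mxs mx /(regular_mod_move hI mxs mx)/regular_mod_rcons[]. Qed.

Lemma ideal_chain_adjoins_X I xs L q : is_ideal I -> (0 < q)%N ->
  (forall z, z \in xs -> m z) -> regular_mod I xs ->
  ideal_chain (adjoins I xs) setT L ->
  ideal_chain (adjoins I [seq x ^+ q | x <- xs]) setT (q ^ size xs * L).
Proof.
move=> + q0; elim: xs I L => [|x xs IH] I L hI mxs hr h; first by rewrite mul1n.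
have mxs' z : z \in xs -> m z by move=> hz; apply: mxs; rewrite inE hz orbT.
have mx : m x by apply/mxs/mem_head.
have mxq : m (x ^+ q) by rewrite -(prednK q0) exprS; apply: ideal_Mr.
have hl := regular_mod_nonzerodivisor_last hI mxs' mx hr.
(* Exchanging x for x^q keeps the sequence regular, and it multiplies the length by q because x is a
   nonzerodivisor modulo the other elements. *)
rewrite /= expnSr -mulnA; apply: IH => //.
- exact: adjoin_ideal.
- by have [] := regular_mod_last hI mxs' mx mxq hr (@nonzerodivisor_X _ _ q hl).
rewrite adjoins_adjoin; apply: ideal_chain_adjoin_X => //; first exact: adjoins_ideal.
by rewrite -adjoins_adjoin.
Qed.

(* Nonzero annihilators of y + x^a modulo I, for distinct a, are eigenspaces of
   multiplication by y for eigenvalues -x^a whose differences are nonzero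
   divisors, hence they are independent. *)
Lemma nonzerodivisor_perturb I x y : is_ideal I -> m x -> nonzerodivisor I x ->
  exists2 a, (1 < a)%N & nonzerodivisor I (y + x ^+ a).
Proof.
move=> hI mx hx; apply: contrapT => hn.
have /choice[z hz] : forall a, exists z, I ((y + x ^+ a.+2) * z) /\ ~ I z.
  move=> a; apply: contrapT => h; apply: hn; exists a.+2 => // r Ir.
  by apply: contrapT => nr; apply: h; exists r.
pose c n := adjoins I (mkseq z n).
have [||N hN] := @acc A c nA.
- by move=> n; apply: adjoins_ideal.
- by move=> n; rewrite /c /mkseq -addn1 iotaD map_cat adjoins_cat; apply: sub_adjoins.
have cz : c N (z N).
  apply/hN/mem_adjoins => //; apply/mapP; exists N => //.
  by rewrite mem_iota add0n ltnSn.
(* [P N] kills z_0, ..., z_(N-1) modulo I, hence also z_N, which lies in the ideal they generate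
   together with I. *)
pose P n := \prod_(i < n) (y + x ^+ i.+2).
have PN : I (z N * P N).
  have : colon I (P N) (z N).
    apply: adjoins_min cz; first exact: colon_ideal.
      by move=> r Ir; apply: ideal_Mr.
    move=> _ /mapP[i + ->]; rewrite mem_iota add0n /= => iN.
    rewrite /colon /P /= (bigD1 (Ordinal iN)) //= mulrA [z i * _]mulrC.
    by apply: ideal_Mr => //; have [] := hz i.
  by [].
(* On z_N the element y acts as -x^(N+2), so the factor y + x^(n+2) acts as x^(n+2) (1 - x^(N-n)), a
   power of x times a unit, and cancels. *)
have : forall n, (n <= N)%N -> I (z N * P n) -> I (z N).
  elim=> [_|n IH nN]; first by rewrite /P big_ord0 mulr1.
  rewrite /P big_ord_recr /= mulrA => h.
  apply: IH; first exact: ltnW.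
  have [b hb] : exists b, (1 - x ^+ (N - n)) * b = 1.
    apply: (unit_1B m_ideal m_proper m_unit).
    rewrite -(@prednK (N - n)) ?subn_gt0 // exprS.
    exact: ideal_Mr.
  have hd : nonzerodivisor I (x ^+ n.+2 * (1 - x ^+ (N - n))).
    by apply: nonzerodivisor_M; [apply: nonzerodivisor_X|apply: nonzerodivisor_unit hb].
  apply: hd; rewrite mulrBr mulr1 -exprD.
  have -> : (n.+2 + (N - n) = N.+2)%N by lia.
  rewrite -/(P n) in h *.
  have -> : (x ^+ n.+2 - x ^+ N.+2) * (z N * P n) =
    z N * P n * (y + x ^+ n.+2) - (y + x ^+ N.+2) * z N * P n by ring.
  by apply: ideal_B => //; apply: ideal_Mr => //; have [] := hz N.
by move=> /(_ N (leqnn _) PN); have [] := hz N.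
Qed.

(** The x_i are exchanged one at a time for y_i + x_i^a with a > 1. The change lies in m^2, so by
    Nakayama the reduction property of the y_i will survive it. *)
Lemma regular_mod_perturb I xs ys : is_ideal I -> size ys = size xs ->
  (forall z, z \in xs -> m z) -> (forall z, z \in ys -> m z) -> regular_mod I xs ->
  exists2 zs, size zs = size ys /\ regular_mod I zs &
     forall i, (i < size ys)%N -> m zs`_i /\ (m ^** 2) (zs`_i - ys`_i).
Proof.
elim: xs ys I => [|x xs IH] [|y ys] I hI //= Es mxs mys hr.
  by exists [::].
have mxs' z : z \in xs -> m z by move=> hz; apply: mxs; rewrite inE hz orbT.
have mys' z : z \in ys -> m z by move=> hz; apply: mys; rewrite inE hz orbT.
have mx : m x by apply/mxs/mem_head.
have my : m y by apply/mys/mem_head.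
have hl := regular_mod_nonzerodivisor_last hI mxs' mx hr.
have [a a1 ha] := nonzerodivisor_perturb y (adjoins_ideal xs hI) mx hl.
have m2a : (m ^** 2) (x ^+ a) by apply: ideal_exp_anti a1 _ _; apply: ideal_exp_X.
have ma : m (x ^+ a) by apply: ideal_exp_sub m2a.
have mya : m (y + x ^+ a) by apply: ideal_D.
have [h1 h2] := regular_mod_last hI mxs' mx mya hr ha.
have [zs [E hz] hzs] := IH ys _ (adjoin_ideal _ hI) (succn_inj Es) mxs' mys' h2.
exists (y + x ^+ a :: zs); first by rewrite /= E.
move=> [|i] hi /=; last exact: hzs.
by split=> //; rewrite addrC addKr.
Qed.

End Local.
End RegularSequences.

(** * Monomials in a regular sequence *)

Fixpoint box (d w : nat) : seq (seq nat) :=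
  if d is d'.+1 then [seq j :: a | j <- iota 0 w, a <- box d' w] else [:: [::]].

Lemma mem_box d w a : (a \in box d w) = (size a == d) && all (fun j => (j < w)%N) a.
Proof.
elim: d a => [|d IH] [|j a] //=.
  by apply/negbTE/negP => /allpairsP[[? ?] []].
apply/allpairsP/idP => [[[i b] [/= + + [-> ->]]]|].
  by rewrite mem_iota add0n /= IH eqSS => -> /andP[-> ->].
rewrite eqSS => /and3P[h1 h2 h3]; exists (j, a).
by rewrite mem_iota add0n /= h2 IH h1 h3.
Qed.

Lemma size_box d w : size (box d w) = (w ^ d)%N.
Proof. by elim: d => //= d IH; rewrite size_allpairs size_iota IH expnS. Qed.

Lemma box_uniq d w : uniq (box d w).
Proof.
elim: d => //= d IH; apply: allpairs_uniq => //; first exact: iota_uniq.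
by move=> [i a] [j b] _ _ /= [-> ->].
Qed.

Lemma sumn_box d w a : a \in box d w -> (sumn a <= d * w.-1)%N.
Proof.
rewrite mem_box => /andP[/eqP <-]; elim: a => //= j a IH /andP[jw /IH h].
by rewrite mulSn leq_add //; lia.
Qed.

Lemma sumn_incr_nth a i : (i < size a)%N -> sumn (incr_nth a i) = (sumn a).+1.
Proof. by elim: a i => [|j a IH] [|i] //= h; rewrite IH // addnS. Qed.

Definition box_count d w n := count (fun a => (sumn a < n)%N) (box d w).

Section Monomials.
Variable A : comNzRingType.
Implicit Types (I : set A) (ys : seq A) (a : seq nat).

Fixpoint monomial ys a : A :=
  match ys, a with
  | y :: ys', j :: a' => y ^+ j * monomial ys' a'
  | _, _ => 1
  end.

Lemma monomial_incr ys a i : size a = size ys -> (i < size ys)%N ->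
  ys`_i * monomial ys a = monomial ys (incr_nth a i).
Proof.
elim: ys a i => [|y ys IH] [|j a] [|i] //= [E] hi; first by rewrite mulrA exprS.
by rewrite mulrCA IH.
Qed.

Lemma monomial_nth ys a i : size a = size ys -> (i < size ys)%N ->
  exists r, monomial ys a = r * ys`_i ^+ nth 0%N a i.
Proof.
elim: ys a i => [|y ys IH] [|j a] [|i] //= [E] hi.
  by exists (monomial ys a); rewrite mulrC.
by have [r ->] := IH a i E hi; exists (y ^+ j * r); rewrite mulrA.
Qed.

Lemma monomial_nseq0 ys : monomial ys (nseq (size ys) 0%N) = 1.
Proof. by elim: ys => //= y ys ->; rewrite expr0 mulr1. Qed.

Lemma monomial_exp I ys a : size a = size ys -> (forall z, z \in ys -> I z) ->
  (I ^** sumn a) (monomial ys a).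
Proof.
elim: ys a => [|y ys IH] [|j a] //= [E] h.
apply: ideal_exp_M; first by apply/ideal_exp_X/h/mem_head.
by apply: IH => // z hz; apply: h; rewrite inE hz orbT.
Qed.

End Monomials.

Section BoxFiltration.
Variables (A : comNzRingType) (ys : seq A) (q : nat).
Hypothesis q_gt0 : (0 < q)%N.
Let d := size ys.
Let J := adjoins [set 0] ys.
Let K := adjoins [set 0] [seq y ^+ q | y <- ys].

(** This is J^n + K, given by finitely many generators over K so that consecutive quotients can be
    measured by counting monomials. *)
Definition box_ideal n : set A :=
  adjoins K [seq monomial ys a | a <- box d q & (n <= sumn a)%N].

Let J_ideal : is_ideal J. Proof. exact/adjoins_ideal/ideal_set0. Qed.
Let K_ideal : is_ideal K. Proof. exact/adjoins_ideal/ideal_set0. Qed.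

Lemma box_ideal_ideal n : is_ideal (box_ideal n). Proof. exact: adjoins_ideal. Qed.

Lemma box_ideal_sub n : K `<=` box_ideal n. Proof. exact: sub_adjoins. Qed.

Lemma mem_box_ideal n a : a \in box d q -> (n <= sumn a)%N -> box_ideal n (monomial ys a).
Proof.
move=> ha hn; apply: mem_adjoins => //; apply/mapP; exists a => //.
by rewrite mem_filter hn.
Qed.

(** Multiplication by y_i raises one exponent: the monomial stays in the box or becomes a multiple
    of y_i^q, which lies in K. *)
Lemma box_ideal_mulr n r a : J r -> a \in box d q -> (n <= sumn a)%N ->
  box_ideal n.+1 (r * monomial ys a).
Proof.
move=> Jr + hn; rewrite mem_box => /andP[/eqP sa ha].
have hc : is_ideal (colon (box_ideal n.+1) (monomial ys a)).
  exact/colon_ideal/box_ideal_ideal.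
apply: (adjoins_min hc _ _ Jr) => [_ ->|_ /(nthP 0)[i hi <-]]; first exact: ideal_0.
rewrite /colon /= monomial_incr //.
have si : size (incr_nth a i) = d by rewrite size_incr_nth sa hi.
have [hq|hq] := ltnP (nth 0%N a i).+1 q.
  apply: mem_box_ideal; last by rewrite sumn_incr_nth // sa.
  rewrite mem_box si eqxx /=; apply/(all_nthP 0%N) => j hj.
  rewrite nth_incr_nth; case: eqP => [<- //|_]; rewrite add0n.
  by move: ha => /(all_nthP 0%N); apply; rewrite sa -si.
have [r' ->] := monomial_nth si hi; rewrite nth_incr_nth eqxx add1n.
apply: box_ideal_sub; apply: ideal_Ml => //.
have -> : (nth 0%N a i).+1 = q.
  by apply/anti_leq; rewrite hq andbT; move: ha => /(all_nthP 0%N); apply; rewrite sa.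
apply: mem_adjoins; first exact: ideal_set0.
by apply/map_f/mem_nth.
Qed.

Lemma ideal_exp_box_ideal n : J ^** n `<=` box_ideal n.
Proof.
elim: n => [|n IH].
  suff /(ideal_1 (box_ideal_ideal 0)) -> : box_ideal 0 1 by [].
  rewrite -(monomial_nseq0 ys); apply: mem_box_ideal => //.
  by rewrite mem_box size_nseq eqxx /=; apply/allP => j /nseqP[->].
apply: ideal_mul_min; first exact: box_ideal_ideal.
move=> r b Jr /IH; rewrite mulrC.
have hc := colon_ideal r (box_ideal_ideal n.+1).
move: b; apply: adjoins_min => //.
  by move=> x Kx; apply: box_ideal_sub; apply: ideal_Mr.
move=> _ /mapP[a + ->]; rewrite mem_filter => /andP[hn ha].
by rewrite /colon /= mulrC; apply: box_ideal_mulr.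
Qed.

Lemma length_box_ideal L n : length_le J setT L ->
  length_le K (box_ideal n) (count (fun a => (n <= sumn a)%N) (box d q) * L).
Proof.
move=> hL.
(* Downward induction on n, measured by k: no vector of the box has sum above d (q - 1), so for
   larger n the ideal is K itself. *)
have [k hk] : exists k, (n + k = maxn n (d * q.-1).+1)%N.
  by exists (maxn n (d * q.-1).+1 - n)%N; rewrite subnKC // leq_maxl.
elim: k n hk => [|k IH] n hk.
  have E : [seq a <- box d q | (n <= sumn a)%N] = [::].
    apply/eqP; rewrite -(negbK (_ == _)) -has_filter; apply/hasPn => a /sumn_box.
    by lia.
  by rewrite /box_ideal -size_filter E /=; apply: length_le0.
have E : box_ideal n = adjoins (box_ideal n.+1) [seq monomial ys a | a <- box d q & sumn a == n].
  apply/seteqP; split.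
    apply: adjoins_min => [||_ /mapP[a + ->]]; first exact/adjoins_ideal/box_ideal_ideal.
      exact: subset_trans (@box_ideal_sub _) (@sub_adjoins _ _ _).
    rewrite mem_filter leq_eqVlt eq_sym => /andP[/orP[e|l] ha].
      apply: mem_adjoins; first exact: box_ideal_ideal.
      by apply/mapP; exists a => //; rewrite mem_filter e.
    by apply: sub_adjoins; apply: mem_box_ideal.
  apply: adjoins_min => [||_ /mapP[a + ->]]; first exact: box_ideal_ideal.
    apply: adjoins_min => [||_ /mapP[a + ->]]; [exact: box_ideal_ideal|exact: box_ideal_sub|].
    by rewrite mem_filter => /andP[/ltnW hn ha]; apply: mem_box_ideal.
  by rewrite mem_filter => /andP[/eqP e ha]; apply: mem_box_ideal; rewrite ?e.
have -> : count (fun a => (n <= sumn a)%N) (box d q) =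
    (count (fun a => (n.+1 <= sumn a)%N) (box d q) +
     count (fun a => sumn a == n) (box d q))%N.
  rewrite -count_predUI.
  rewrite [X in (_ + X)%N](_ : _ = 0%N) ?addn0.
    by apply: eq_count => a /=; rewrite leq_eqVlt orbC eq_sym.
  apply/eqP; rewrite -leqn0 leqNgt -has_count; apply/hasPn => a _ /=.
  by lia.
rewrite mulnDl; apply: (@length_le_cat _ _ (box_ideal n.+1)).
- exact: box_ideal_ideal.
- exact: box_ideal_ideal.
- exact: box_ideal_sub.
- by rewrite E; apply: sub_adjoins.
- by apply: IH; lia.
rewrite E -size_filter -(size_map (monomial ys)).
apply: length_le_adjoins hL _; first exact: box_ideal_ideal.
move=> r z Jr /mapP[a + ->]; rewrite mem_filter => /andP[/eqP e ha].
by apply: box_ideal_mulr; rewrite ?e.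
Qed.

End BoxFiltration.

(** * The length estimate from a regular reduction of m *)

Section LowerBound.
Variables (A : comNzRingType) (m : set A).
Hypotheses (m_ideal : is_ideal m) (m_proper : ~ m 1).
Hypothesis m_unit : forall a, ~ m a -> exists b, a * b = 1.
Hypothesis nA : noetherian A.
Variable q : nat.
Hypothesis q_gt0 : (0 < q)%N.
Hypothesis frobD : forall x y : A, (x + y) ^+ q = x ^+ q + y ^+ q.

Implicit Types (I J : set A).

Lemma frobenius_adjoin I z : is_ideal I ->
  frobenius_power (adjoin I z) q `<=` adjoin (frobenius_power I q) (z ^+ q).
Proof.
move=> hI; apply: frobenius_min; first exact/adjoin_ideal/frobenius_ideal.
move=> x [a Ia]; exists (a ^+ q).
have -> : x ^+ q - a ^+ q * z ^+ q = (x - a * z) ^+ q.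
  apply/eqP; rewrite subr_eq -exprMn -frobD subrK //.
exact: mem_frobenius.
Qed.

Lemma frobenius_adjoins (ys : seq A) :
  frobenius_power (adjoins [set 0] ys) q `<=` adjoins [set 0] [seq y ^+ q | y <- ys].
Proof.
have hI : is_ideal (adjoins [set 0] [seq y ^+ q | y <- ys]).
  exact/adjoins_ideal/ideal_set0.
apply: frobenius_min => //.
have hJ : is_ideal [set x | adjoins [set 0] [seq y ^+ q | y <- ys] (x ^+ q)].
  apply/is_idealP; split=> /=; first by rewrite expr0n gtn_eqF //; apply: ideal_0.
  move=> a u v hu hv; rewrite frobD exprMn.
  by apply: ideal_D => //; apply: ideal_Ml.
apply: (adjoins_min hJ) => [_ ->|y hy] /=.
  by rewrite expr0n gtn_eqF //; apply: ideal_0.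
by apply: mem_adjoins; [apply: ideal_set0|apply: map_f].
Qed.

Section Filtration.
Variables (n N T : nat).
Let F (I : set A) := ideal_add (m ^** n) (frobenius_power I q).
Hypothesis hT : length_le (F m) setT T.

(* A composition series of A/I with factors A/m yields a filtration of A/F(I)
   whose factors are quotients of A/F(m). *)
Lemma length_frobenius I k : is_ideal I -> m ^** N `<=` I ->
  ideal_chain (F I) setT k -> exists2 l, ideal_chain I setT l & (k <= l * T)%N.
Proof.
move=> hI mI; have [B hB] := length_le_exp m_unit N nA.
have F_ideal J : is_ideal (F J).
  by apply: ideal_add_ideal; [apply: ideal_exp_ideal|apply: frobenius_ideal].
move: k; move: I hI mI.
apply: (@primary_ind _ _ (fun I => forall k, ideal_chain (F I) setT k ->
  exists2 l, ideal_chain I setT l & (k <= l * T)%N) _ _ hB).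
  move=> k h; exists 0%N; first by apply: ideal_chain0 => //; apply: ideal_setT.
  suff E : F setT = setT by rewrite E in h; apply: length_le0 h.
  apply: ideal_1; first exact: F_ideal.
  apply: sub_ideal_addr; first exact: ideal_exp_ideal.
  by rewrite -[1](expr1n _ q); apply: mem_frobenius.
move=> I z hI mI nz mz IH k.
have sF : F I `<=` F (adjoin I z).
  apply: ideal_add_mono; first exact: subset_refl.
  by apply: frobenius_mono; apply: sub_adjoin.
case/(ideal_chain_split (F_ideal (adjoin I z)) (@ideal_setT A) sF) => // i [j [<- [hi hj]]].
have [l hl jl] := IH _ hj.
exists l.+1.
  rewrite -add1n; apply: ideal_chain_cat hl; apply: ideal_chain1 => //; first exact: adjoin_ideal.
  by split; [apply: sub_adjoin|move=> h; apply: nz; apply: h; apply: mem_adjoin].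
rewrite mulSn leq_add //; apply: hT.
(* F(I + (z))/F(I) is generated by z^q and killed by F(m): for x in m the product x z lies in I, so
   x^q z^q lies in I^[q]. *)
apply: (@ideal_chain_adjoin _ (F I) _ (z ^+ q)) => //.
  move=> _ [u mu [v mv <-]]; rewrite mulrDl; apply: ideal_D => //.
    by apply: ideal_Mr => //; apply: sub_ideal_addl mu; apply: frobenius_ideal.
  have : colon (F I) (z ^+ q) v.
    apply: frobenius_min mv; first exact: colon_ideal.
    move=> x mx; rewrite /colon /= -exprMn.
    apply: sub_ideal_addr; first exact: ideal_exp_ideal.
    by apply: mem_frobenius; apply: mz.
  by [].
apply: ideal_chain_mono hi => //; apply: ideal_add_min.
- exact: adjoin_ideal.
- move=> x mx; apply: sub_adjoin; apply: sub_ideal_addl mx; exact: frobenius_ideal.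
apply: subset_trans (frobenius_adjoin hI) (adjoin_mono _).
apply: sub_ideal_addr; exact: ideal_exp_ideal.
Qed.

End Filtration.

Lemma reduction_exp J c k : is_ideal J ->
  m ^** c.+1 `<=` ideal_mul J (m ^** c) -> m ^** (k + c) `<=` ideal_mul (J ^** k) (m ^** c).
Proof.
move=> hJ hr; elim: k => [|k IH].
  by move=> x mx; rewrite -[x]mul1r; apply: mem_ideal_mul.
rewrite addSn; apply: ideal_mul_min; first exact: ideal_mul_ideal.
move=> a b ma /IH hb; rewrite mulrC.
have hi := ideal_mul_ideal (J ^** k.+1) (m ^** c).
have : colon (ideal_mul (J ^** k.+1) (m ^** c)) a b.
  apply: ideal_mul_min hb; first exact: colon_ideal.
  move=> u v Ju mv; rewrite /colon /= -mulrA mulrC.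
  have : ideal_mul J (m ^** c) (v * a) by apply: hr; rewrite mulrC; apply: mem_ideal_mul.
  apply: (ideal_mul_min (colon_ideal u hi)) => j w Jj mw.
  rewrite /colon /= mulrAC; apply: mem_ideal_mul => //; exact: mem_ideal_mul.
by [].
Qed.

(** Let L be the length of A/J and K the ideal of the y_i^q. Then A/K has length at least q^d L, and
    [box_ideal] at n - c takes up at most L for each a in the box with |a| >= n - c. This leaves L
    for each other a, and [length_frobenius] lets L cancel. *)
Lemma ideal_chain_box (ys : seq A) c n :
  (forall y, y \in ys -> m y) -> regular_mod [set 0] ys ->
  m ^** c.+1 `<=` ideal_mul (adjoins [set 0] ys) (m ^** c) ->
  ideal_chain (ideal_add (m ^** n) (frobenius_power m q)) setT (box_count (size ys) q (n - c)).
Proof.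
move=> mys hr hred; set J := adjoins [set 0] ys in hred *.
have hJ : is_ideal J by apply/adjoins_ideal/ideal_set0.
have Jm : J `<=` m by apply: adjoins_min => // _ ->; apply: ideal_0.
have mJ : m ^** c.+1 `<=` J by apply: subset_trans hred (ideal_mul_subl hJ).
have [B hB] := length_le_exp m_unit c.+1 nA.
have [L cL lL] := exact_length hJ (fun _ _ => I) (length_le_mono mJ (fun _ h => h) hB).
have L0 : (0 < L)%N.
  apply: lL; apply: ideal_chain1 => //; first exact: ideal_setT.
  by split=> // h; apply: m_proper; apply: Jm; apply: h.
have [B' hB'] := length_le_exp m_unit n nA.
set Fm := ideal_add _ _.
have hF : is_ideal Fm.
  by apply: ideal_add_ideal; [apply: ideal_exp_ideal|apply: frobenius_ideal].
have [|T cT lT] := exact_length hF (fun _ _ => I) (n := B').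
  apply: length_le_mono hB' => //; apply: sub_ideal_addl; exact: frobenius_ideal.
suff h : ideal_chain (ideal_add (m ^** n) (frobenius_power J q)) setT
             (box_count (size ys) q (n - c) * L).
  have [l /lL hl hk] := length_frobenius lT hJ mJ h.
  apply: ideal_chain_leq cT; rewrite -(leq_pmul2r L0) (leq_trans hk) //.
  by rewrite [(T * L)%N]mulnC leq_mul2r hl orbT.
pose W := box_ideal ys q (n - c).
have KW : adjoins [set 0] [seq y ^+ q | y <- ys] `<=` W by apply: box_ideal_sub.
have hW : is_ideal W by apply: box_ideal_ideal.
have hc := ideal_chain_adjoins_X m_ideal m_proper m_unit nA (@ideal_set0 A) q_gt0 mys hr cL.
have [//|a [b [Eab [ha hb]]]] := ideal_chain_split hW (@ideal_setT A) KW _ hc.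
have la := length_box_ideal q_gt0 (n := n - c) lL ha.
have hb' : (box_count (size ys) q (n - c) * L <= b)%N.
  have : (q ^ size ys = box_count (size ys) q (n - c) +
     count (fun a => (n - c <= sumn a)%N) (box (size ys) q))%N.
    rewrite -size_box -(count_predC (fun a => (sumn a < n - c)%N)); congr (_ + _)%N.
    by apply: eq_count => x /=; rewrite -leqNgt.
  move=> E; move: Eab; rewrite E mulnDl => Eab.
  by rewrite -(leq_add2r (count (fun a => (n - c <= sumn a)%N) (box (size ys) q) * L))
     -Eab addnC leq_add2l.
apply: ideal_chain_leq hb' _; apply: ideal_chain_mono hb => //.
apply: ideal_add_min => //; last exact: subset_trans (@frobenius_adjoins ys) KW.
(* For n <= c the truncated difference is 0, and [box_ideal] in degree 0 is the whole ring. *)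
have [nc|cn] := leqP n c.
  have -> : W = setT; last by [].
  apply: ideal_1 => //; rewrite /W (eqP nc); apply: ideal_exp_box_ideal => //.
rewrite -{1}(subnK (ltnW cn)).
apply: subset_trans (reduction_exp (k := n - c) hJ hred) _.
apply: subset_trans (ideal_mul_subl (ideal_exp_ideal _ _)) _.
exact: ideal_exp_box_ideal.
Qed.

End LowerBound.

(** * Reductions *)

Section Digits.
Variable w : nat.

Definition digits_val (a : seq nat) : nat := foldr (fun j v => j + w * v)%N 0%N a.

Lemma digits_val_lt d a : a \in box d w -> (digits_val a < w ^ d)%N.
Proof.
rewrite mem_box => /andP[/eqP <-]; elim: a => //= j a IH /andP[jw /IH h].
rewrite expnS; have : (w * (digits_val a).+1 <= w * w ^ size a)%N by rewrite leq_mul2l h orbT.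
by rewrite mulnS; lia.
Qed.

Lemma digits_val_inj d : {in box d w &, injective digits_val}.
Proof.
elim: d => [|d IH] a b; first by rewrite !inE => /eqP -> /eqP ->.
move=> /allpairsP[[i a'] [/= + ha ->]] /allpairsP[[j b'] [/= + hb ->]].
rewrite !mem_iota !add0n => /= iw jw /= E.
have Eij : i = j.
  have M u v : (u < w)%N -> ((u + w * v) %% w)%N = u.
    by move=> uw; rewrite addnC mulnC modnMDl modn_small.
  by rewrite -(M i (digits_val a')) // E M.
move: E; rewrite Eij => /addnI/eqP; rewrite eqn_pmul2l; last exact: leq_trans iw.
by move=> /eqP/(IH _ _ ha hb) ->.
Qed.

(** Kronecker substitution in homogeneous form: for k = 0 the i-th variable becomes t^(w^i - 1), so
    variable 0 becomes 1, and the factor t^n in degree n restores the base w expansion. Distinct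
    monomials of the box thus give distinct powers of t. *)
Lemma monomial_digits (A : comNzRingType) (t : A) a k :
  (0 < w)%N ->
  monomial [seq t ^+ (w ^ i).-1 | i <- iota k (size a)] a * t ^+ sumn a
    = t ^+ (w ^ k * digits_val a).
Proof.
move=> w0; elim: a k => [|j a IH] k; first by rewrite /= muln0 mulr1.
rewrite /= exprD mulrACA IH -exprM -!exprD expnSr; congr (_ ^+ _).
have : (0 < w ^ k)%N by rewrite expn_gt0 w0.
by case: (w ^ k)%N => // v _; rewrite /= mulnDr mulnA; congr (_ + _)%N; rewrite mulSn addnC.
Qed.

End Digits.

Section Reductions.
Variables (A : comNzRingType) (m : set A).
Hypotheses (m_ideal : is_ideal m) (m_proper : ~ m 1).
Hypothesis m_unit : forall a, ~ m a -> exists b, a * b = 1.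
Hypothesis nA : noetherian A.

Lemma max_prime a b : m (a * b) -> ~ m b -> m a.
Proof.
move=> mab /m_unit[c E]; rewrite -[a]mulr1 -E mulrA; exact: ideal_Mr.
Qed.

(** The bound on the number of roots over the field A/m, carried out over A: dividing by X - t_0
    leaves a remainder in m, and the differences t_j - t_0 are units. *)
Lemma roots_mod_max (P : {poly A}) N (t : nat -> A) :
  (size P <= N)%N -> (forall i j, (i < j < N)%N -> ~ m (t j - t i)) ->
  (forall i, (i < N)%N -> m P.[t i]) -> forall k, m P`_k.
Proof.
elim: N P t => [|N IH] P t sP ht hP k.
  by move: sP; rewrite leqn0 size_poly_eq0 => /eqP ->; rewrite coef0; apply: ideal_0.
have [Q EQ] : exists Q, P - (P.[t 0%N])%:P = Q * ('X - (t 0%N)%:P).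
  by apply/factor_theorem; rewrite /root !hornerE subrr.
have EP : P = Q * ('X - (t 0%N)%:P) + (P.[t 0%N])%:P by rewrite -EQ subrK.
have sQ : (size Q <= N)%N.
  have [->|Q0] := eqVneq Q 0; first by rewrite size_poly0.
  have : size (Q * ('X - (t 0%N)%:P)) = (size Q).+1.
    by rewrite size_Mmonic ?monicXsubC // size_XsubC addn2.
  rewrite -EQ => E; rewrite -ltnS -E (leq_trans (size_polyD _ _)) // geq_max sP.
  by rewrite size_polyN (leq_trans (size_polyC_leq1 _)).
have mQ : forall k, m Q`_k.
  apply: (IH Q (fun i => t i.+1) sQ) => [i j ij|i iN]; first exact: ht.
  apply: (@max_prime _ (t i.+1 - t 0%N)); last exact: ht.
  have := hP i.+1 iN; rewrite {1}EP !hornerE => h.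
  by apply: ideal_Dl h _ => //; apply: hP.
rewrite EP coefD coefC mulrBr coefB coefMX coefMC.
apply: ideal_D => //; last by case: eqP => _; [apply: hP|apply: ideal_0].
apply: ideal_B => //; last exact: ideal_Mr.
by case: eqP => _ //; apply: ideal_0.
Qed.

Lemma mem_adjoins_map (I : set A) (T : eqType) (s : seq T) (f : T -> A) x :
  uniq s -> adjoins I [seq f a | a <- s] x ->
  exists c : T -> A, I (x - \sum_(a <- s) c a * f a).
Proof.
elim: s I => [|a s IH] I /=; first by move=> _ Ix; exists (fun _ => 0); rewrite big_nil subr0.
move=> /andP[as_ us] /IH[] // c [e Ie].
exists (fun b => if b == a then e else c b).
rewrite big_cons eqxx opprD addrA addrAC; move: Ie; congr I; congr (_ - _ - _).
apply: eq_big_seq => b bs; case: eqP => // E.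
by rewrite -E bs in as_.
Qed.

(** If no monomial were redundant modulo m^(n+1) and the earlier monomials of its degree n,
    adjoining them degree by degree would give one strict step per monomial, a chain of w^r steps
    above m^(r w). *)
Lemma box_relation (ys : seq A) w : (0 < w)%N -> (0 < size ys)%N ->
  (forall y, y \in ys -> m y) ->
  ~ ideal_chain (m ^** (size ys * w)) setT (w ^ size ys) ->
  exists n s a0 (c : seq nat -> A),
   [/\ forall a, a \in a0 :: s -> a \in box (size ys) w /\ sumn a = n,
       a0 \notin s
     & (m ^** n.+1) (monomial ys a0 - \sum_(a <- s) c a * monomial ys a)].
Proof.
move=> w0 r0 mys; set r := size ys => hn; apply: contrapT => hr.
apply: hn; have -> : (w ^ r = count (fun a => (sumn a < r * w)%N) (box r w))%N.
  rewrite -size_box; apply/esym/eqP; rewrite -all_count; apply/allP => a /sumn_box.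
  by move=> h; apply: leq_ltn_trans h _; rewrite ltn_pmul2l // prednK.
elim: (r * w)%N => [|n IH].
  rewrite (eq_count (a2 := pred0)) // count_pred0; apply: ideal_chain0 => //.
  exact: ideal_setT.
have -> : count (fun a => (sumn a < n.+1)%N) (box r w) =
  (count (fun a => sumn a == n) (box r w) + count (fun a => (sumn a < n)%N) (box r w))%N.
  rewrite -count_predUI [X in (_ + X)%N](_ : _ = 0%N) ?addn0.
    by apply: eq_count => a /=; rewrite ltnS leq_eqVlt.
  apply/eqP; rewrite -leqn0 leqNgt -has_count; apply/hasPn => a _ /=.
  by lia.
apply: ideal_chain_cat IH.
set s := [seq a <- box r w | sumn a == n].
have us : uniq s by apply/filter_uniq/box_uniq.
have hs a : a \in s -> a \in box r w /\ sumn a = n.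
  by rewrite mem_filter => /andP[/eqP -> ->].
rewrite -size_filter -/s -(size_map (monomial ys)).
apply: (@ideal_chain_mono _ (m ^** n.+1) (adjoins (m ^** n.+1) [seq monomial ys a | a <- s])) => //.
  apply: adjoins_min; [exact: ideal_exp_ideal|exact: ideal_exp_anti|].
  move=> _ /mapP[a /hs[ha <-] ->]; apply: monomial_exp => //.
  by move: ha; rewrite mem_box => /andP[/eqP].
apply: ideal_chain_adjoins; first exact: ideal_exp_ideal.
rewrite size_map => i hi; rewrite (nth_map [::]) // -map_take => h; apply: hr.
have [|c hc] := mem_adjoins_map _ h; first exact: take_uniq.
exists n, (take i s), (nth [::] s i), c; split=> // [a|].
  rewrite inE => /orP[/eqP ->|/mem_take]; last exact: hs.
  by apply/hs/mem_nth.
move: us; rewrite -{1}(cat_take_drop i s) (drop_nth [::]) // cat_uniq => /and3P[_ + _].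
by rewrite /= negb_or => /andP[].
Qed.

Section Elimination.
Variables (J : set A) (y0 : A).
Hypotheses (J_ideal : is_ideal J) (Jm : J `<=` m) (my0 : m y0).

(** Congruence modulo J that keeps track of the degree n; mere membership in J would be too weak for
    the Nakayama argument in [reduce_one]. *)
Let Q n := ideal_mul J (m ^** n.-1).

Let close n (u v : A) := [/\ (m ^** n) u, (m ^** n) v & Q n (u - v)].

Let mulQ k l u v : (m ^** k) u -> Q l v -> Q (k + l) (u * v).
Proof.
move=> mu Qv; have hc := colon_ideal u (ideal_mul_ideal J (m ^** (k + l).-1)).
suff : colon (Q (k + l)) u v by rewrite /colon /= mulrC.
apply: (ideal_mul_min hc) Qv => j b Jj mb.
rewrite /colon /= -mulrA; apply: mem_ideal_mul => //; rewrite mulrC.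
apply: (@ideal_exp_anti _ _ _ (k + l.-1)); first by lia.
exact: ideal_exp_M.
Qed.

Let closeM k l u v u' v' : close k u v -> close l u' v' ->
  close (k + l) (u * u') (v * v').
Proof.
move=> [a1 a2 a3] [b1 b2 b3]; split; try exact: ideal_exp_M.
have -> : u * u' - v * v' = u * (u' - v') + v' * (u - v) by ring.
apply: (ideal_D (ideal_mul_ideal _ _)); first exact: mulQ.
by rewrite addnC; apply: mulQ.
Qed.

Let close1 : close 0 1 1.
Proof. by split=> //; rewrite subrr; apply: ideal_0; apply: ideal_mul_ideal. Qed.

Let closeX n u v : close 1 u v -> close n (u ^+ n) (v ^+ n).
Proof.
move=> h; elim: n => [|n IH]; first exact: close1.
by rewrite !exprS -add1n; apply: closeM.
Qed.

Let close_monomial (ys ts : seq A) a : size a = size ys -> size ts = size ys ->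
  (forall i, (i < size ys)%N -> close 1 ys`_i (ts`_i * y0)) ->
  close (sumn a) (monomial ys a) (monomial ts a * y0 ^+ sumn a).
Proof.
elim: ys ts a => [|y ys IH] [|t ts] [|j a] //= => [_ _ _|[E1] [E2] h].
  by rewrite mulr1; apply: close1.
have -> : t ^+ j * monomial ts a * y0 ^+ (j + sumn a) =
  (t * y0) ^+ j * (monomial ts a * y0 ^+ sumn a) by rewrite exprD exprMn; ring.
apply: closeM; first by apply: closeX; apply: (h 0%N).
by apply: IH => // i hi; apply: (h i.+1).
Qed.

Lemma ideal_exp_adjoin_sub n : (adjoin J y0) ^** n.+1 `<=` adjoin (ideal_mul J (m ^** n)) (y0 ^+ n.+1).
Proof.
have hQ k : is_ideal (ideal_mul J (m ^** k)) by apply: ideal_mul_ideal.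
elim: n => [|n IH].
  apply: subset_trans (ideal_exp_1sub (adjoin_ideal y0 J_ideal)) _.
  apply: adjoin_mono => x Jx; rewrite -[x]mulr1; exact: mem_ideal_mul.
rewrite ideal_expS; apply: ideal_mul_min; first exact: adjoin_ideal.
move=> x b [f Jf] /IH[e Qe]; exists (f * e).
have -> : x * b - f * e * y0 ^+ n.+2 =
  x * (b - e * y0 ^+ n.+1) + (x - f * y0) * (e * y0 ^+ n.+1).
  by rewrite (exprS y0 n.+1); ring.
apply: (ideal_D (hQ _)).
  apply: (@mulQ 1 n.+1) => //; apply: ideal_exp_1.
  rewrite -(subrK (f * y0) x); apply: ideal_D => //; first exact: Jm.
  exact: ideal_Ml.
by apply: mem_ideal_mul => //; apply: (ideal_Ml (ideal_exp_ideal _ _)); apply: ideal_exp_X.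
Qed.

(* Modulo J one has y_i = t_i y_0, so a homogeneous relation between the y_i
   whose polynomial does not vanish at t expresses a power of y_0. *)
Lemma eliminate (ys ts : seq A) n s a0 (c : seq nat -> A) :
  size ts = size ys ->
  (forall i, (i < size ys)%N -> m ys`_i /\ J (ys`_i - ts`_i * y0)) ->
  (forall a, a \in a0 :: s -> size a = size ys /\ sumn a = n) ->
  (m ^** n.+1) (monomial ys a0 - \sum_(a <- s) c a * monomial ys a) ->
  ~ m (monomial ts a0 - \sum_(a <- s) c a * monomial ts a) ->
  ideal_add (m ^** n.+1) (ideal_mul J (m ^** n.-1)) (y0 ^+ n).
Proof.
move=> sts hys hs hrel; set G := monomial ts a0 - _ => /m_unit[b Eb].
set W := ideal_add _ _.
have hQ : is_ideal (Q n) by apply: ideal_mul_ideal.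
have hW : is_ideal W by apply: ideal_add_ideal => //; apply: ideal_exp_ideal.
rewrite -[y0 ^+ n]mul1r -Eb mulrAC mulrC; apply: ideal_Ml => //.
have hy i : (i < size ys)%N -> close 1 ys`_i (ts`_i * y0).
  move=> /hys[my Jy]; split; first exact: ideal_exp_1.
    by apply: ideal_exp_1; apply: ideal_Ml.
  by rewrite -[_ - _]mulr1; apply: mem_ideal_mul.
have hc a : a \in a0 :: s -> Q n (monomial ys a - monomial ts a * y0 ^+ n).
  by move=> /hs[E <-]; have [] := close_monomial E sts hy.
set R := monomial ys a0 - _ in hrel.
have hRG : Q n (R - G * y0 ^+ n).
  have -> : R - G * y0 ^+ n = (monomial ys a0 - monomial ts a0 * y0 ^+ n) -
     \sum_(a <- s) c a * (monomial ys a - monomial ts a * y0 ^+ n).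
    rewrite /R /G mulrBl mulr_suml.
    under [in RHS]eq_bigr => a _ do rewrite mulrBr mulrA.
    by rewrite sumrB; ring.
  apply: (ideal_B hQ); first by apply: hc; apply: mem_head.
  rewrite big_seq; apply: (ideal_sum hQ) => a ha; apply: (ideal_Ml hQ).
  by apply: hc; rewrite inE ha orbT.
exists R => //; exists (G * y0 ^+ n - R); first exact: (ideal_BC hQ).
by rewrite addrC subrK.
Qed.

End Elimination.

Section Reduce.
Variables (xs : seq A) (L w D : nat) (t : nat -> A).
Hypothesis mxs : forall x, x \in xs -> m x.
Hypothesis length_xs : length_le (adjoins [set 0] xs) setT L.
Hypothesis w_gt0 : (0 < w)%N.
Hypothesis t_sep : forall i j, (i < j < D)%N -> ~ m (t j - t i).
Let d := size xs.

(** m^n contains the powers x_i^n. So the length grows at most like n^d, which is what limits the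
    number of generators of a reduction. *)
Lemma length_le_exp_params n : length_le (m ^** n) setT (n ^ d * L).
Proof.
apply: length_le_mono (length_le_adjoins_X (q := n) (@ideal_set0 A) length_xs) => //.
apply: adjoins_min; first exact: ideal_exp_ideal.
  by move=> _ ->; apply: ideal_0; apply: ideal_exp_ideal.
by move=> _ /mapP[x /mxs mx ->]; apply: ideal_exp_X.
Qed.

Lemma reduce_one (ys : seq A) c : ((size ys * w) ^ d * L < w ^ size ys)%N ->
  (w ^ size ys <= D)%N -> (forall y, y \in ys -> m y) ->
  m ^** c.+1 `<=` ideal_mul (adjoins [set 0] ys) (m ^** c) ->
  (0 < size ys)%N ->
  exists zs e, [/\ size zs = (size ys).-1, forall z, z \in zs -> m z &
    m ^** e.+1 `<=` ideal_mul (adjoins [set 0] zs) (m ^** e)].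
Proof.
move=> hw hD mys hred r0.
have [|n [s [a0 [k [hs a0s hrel]]]]] := @box_relation ys w w_gt0 r0 mys.
  by move=> /length_le_exp_params; rewrite leqNgt hw.
(* The relation after Kronecker substitution. Its coefficient at [a0] is 1 and its degree is below
   w^r, so some t_j is not a root modulo m. *)
pose P : {poly A} := 'X^(digits_val w a0) - \sum_(a <- s) k a *: 'X^(digits_val w a).
have P1 : P`_(digits_val w a0) = 1.
  rewrite coefB coefXn eqxx coef_sum big1_seq ?subr0 // => a /= ha.
  rewrite coefZ coefXn; case: eqP => [E|]; last by rewrite mulr0.
  have [h0 _] := hs a0 (mem_head _ _).
  have [h1 _] : a \in box (size ys) w /\ sumn a = n by apply: hs; rewrite inE ha orbT.
  by move: a0s; rewrite (digits_val_inj h0 h1 E) ha.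
have sP : (size P <= w ^ size ys)%N.
  rewrite (leq_trans (size_polyD _ _)) // geq_max size_polyXn size_polyN.
  have h a : a \in a0 :: s -> (digits_val w a < w ^ size ys)%N.
    by move=> /hs[/digits_val_lt].
  rewrite h ?mem_head //= big_seq.
  apply: (leq_trans (size_sum _ _ _)); apply/bigmax_leqP_seq => a ha _.
  rewrite (leq_trans (size_scale_leq _ _)) // size_polyXn h //.
  by rewrite inE ha orbT.
have [j hj] : exists j, ~ m P.[t j].
  apply: contrapT => h; apply: m_proper; rewrite -P1.
  apply: (roots_mod_max sP (t := t)) => [i j /andP[ij jw]|i _].
    by apply: t_sep; rewrite ij (leq_trans jw).
  by apply: contrapT => hi; apply: h; exists i.
pose ts := [seq t j ^+ (w ^ i).-1 | i <- iota 0 (size ys)].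
have sts : size ts = size ys by rewrite size_map size_iota.
(* The first entry of [ts] is 1, so the difference with index 0 vanishes and r - 1 elements
   remain. *)
pose y0 := ys`_0; pose zs := [seq ys`_i - ts`_i * y0 | i <- iota 1 (size ys).-1].
pose J := adjoins [set 0] zs.
have my i : (i < size ys)%N -> m ys`_i by move=> hi; apply/mys/mem_nth.
have my0 : m y0 by apply: my.
have mzs z : z \in zs -> m z.
  move=> /mapP[i + ->]; rewrite mem_iota => hi.
  by apply: ideal_B => //; [apply: my; lia|apply: ideal_Ml].
have hJ : is_ideal J by apply/adjoins_ideal/ideal_set0.
have Jm : J `<=` m by apply: adjoins_min => // _ ->; apply: ideal_0.
have Jy i : (i < size ys)%N -> J (ys`_i - ts`_i * y0).
  case: i => [|i] hi.
    rewrite (nth_map 0%N) ?size_iota // nth_iota // expn0 expr0 mul1r subrr.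
    exact: ideal_0.
  apply: mem_adjoins; first exact: ideal_set0.
  by apply/mapP; exists i.+1 => //; rewrite mem_iota; lia.
have hn : ideal_add (m ^** n.+1) (ideal_mul J (m ^** n.-1)) (y0 ^+ n).
  apply: (eliminate my0 sts _ _ hrel).
  - by move=> i hi; split; [apply: my|apply: Jy].
  - by move=> a /hs[]; rewrite mem_box => /andP[/eqP].
  move=> mG; apply: hj.
  have -> : P.[t j] = (monomial ts a0 - \sum_(a <- s) k a * monomial ts a) * t j ^+ n.
    have h a : a \in a0 :: s -> monomial ts a * t j ^+ n = t j ^+ digits_val w a.
      move=> /hs[]; rewrite mem_box => /andP[/eqP sa _] <-.
      by have := monomial_digits (t j) a 0 w_gt0; rewrite mul1n sa.
    rewrite /P hornerD hornerN hornerXn horner_sum mulrBl h ?mem_head //.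
    congr (_ - _); rewrite mulr_suml; apply: eq_big_seq => a ha.
    by rewrite !hornerE -mulrA h // inE ha orbT.
  exact: ideal_Mr.
case: n hn {hrel hs} => [|n] hn.
  case: m_proper; move: hn; rewrite expr0.
  apply: ideal_add_min => //; first exact: ideal_exp_1sub.
  by apply: subset_trans (ideal_mul_subl hJ) Jm.
(* The relation has degree n + 1 here. With I the ideal of [ys], I^(n+1) lies in m^(n+2) + J m^n and
   m^(n+1+c) lies in I^(n+1) m^c. So m^(n+c+1) lies in J m^(n+c) + m m^(n+c+1), and Nakayama removes
   the last term. *)
exists zs, (n + c)%N; split=> //; first by rewrite size_map size_iota.
have h0 : adjoins [set 0] ys `<=` adjoin J y0.
  have hJ0 := adjoin_ideal y0 hJ.
  apply: adjoins_min => // [_ ->|_ /(nthP 0)[i hi <-]]; first exact: ideal_0.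
  by exists ts`_i; apply: Jy.
have hJn : (adjoins [set 0] ys) ^** n.+1 `<=` ideal_add (m ^** n.+2) (ideal_mul J (m ^** n)).
  apply: subset_trans (ideal_exp_mono (n := n.+1) h0) _.
  apply: subset_trans (ideal_exp_adjoin_sub hJ Jm my0 (n := n)) _.
  apply: adjoin_min => //; first by apply: ideal_add_ideal; [apply: ideal_exp_ideal|apply: ideal_mul_ideal].
  by apply: sub_ideal_addr; apply: ideal_exp_ideal.
have hI := ideal_mul_ideal J (m ^** (n + c)).
apply: (nakayama m_ideal m_proper m_unit nA hI (ideal_exp_ideal _ _)).
have hys : is_ideal (adjoins [set 0] ys) by apply/adjoins_ideal/ideal_set0.
apply: subset_trans (reduction_exp (k := n.+1) hys hred) _.
apply: subset_trans (ideal_mul_mono hJn (fun _ h => h)) _.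
have hT : is_ideal (ideal_add (ideal_mul J (m ^** (n + c))) (ideal_mul m (m ^** (n + c).+1))).
  by apply: ideal_add_ideal => //; apply: ideal_mul_ideal.
apply: ideal_mul_min => // _ b [u mu [v Jv <-]] mb; rewrite mulrDl addrC.
apply: ideal_D => //.
  apply: sub_ideal_addl; first exact: ideal_mul_ideal.
  have : colon (ideal_mul J (m ^** (n + c))) b v.
    apply: ideal_mul_min Jv; first exact: colon_ideal.
    move=> j' x Jj mx; rewrite /colon /= -mulrA; apply: mem_ideal_mul => //.
    exact: ideal_exp_M.
  by [].
apply: sub_ideal_addr => //; rewrite -ideal_expS -!addSn; exact: ideal_exp_M.
Qed.

Lemma exists_reduction (gs : seq A) : m = adjoins [set 0] gs ->
  (w ^ size gs <= D)%N ->
  (forall r, (d < r <= size gs)%N -> ((r * w) ^ d * L < w ^ r)%N) ->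
  exists zs e, [/\ size zs = d, forall z, z \in zs -> m z &
    m ^** e.+1 `<=` ideal_mul (adjoins [set 0] zs) (m ^** e)].
Proof.
move=> Em hD hr.
have mgs g : g \in gs -> m g.
  by move=> h; rewrite Em; apply: mem_adjoins h; apply: ideal_set0.
(* Starting from generators of m with exponent 0, one generator is removed at a time while more than
   d are left. *)
have H k : exists zs e, [/\ (size zs <= maxn d (size gs - k))%N,
    forall z, z \in zs -> m z &
    m ^** e.+1 `<=` ideal_mul (adjoins [set 0] zs) (m ^** e)].
  elim: k => [|k [zs [e [szs mzs hz]]]].
    exists gs, 0%N; split=> //; first by rewrite subn0 leq_maxr.
    by rewrite -Em ideal_expS.
  have [sd|ds] := leqP (size zs) d.
    by exists zs, e; split=> //; rewrite (leq_trans sd) // leq_maxl.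
  have sg : (size zs <= size gs - k)%N.
    by move: szs; rewrite leq_max leqNgt ds.
  have [|||zs' [e' [szs' mzs' hz']]] := @reduce_one zs e _ _ mzs hz.
  - by apply: hr; rewrite ds (leq_trans sg) ?leq_subr.
  - by rewrite (leq_trans _ hD) // leq_pexp2l // (leq_trans sg) ?leq_subr.
  - exact: leq_trans ds.
  exists zs', e'; split=> //; rewrite szs' leq_max; apply/orP; right.
  by rewrite subnS -!subn1 leq_sub2r.
have [zs [e [szs mzs hz]]] := H (size gs).
rewrite subnn maxn0 in szs.
(* Zeros bring the number to exactly d, as needed to match the list with the regular sequence. *)
exists (zs ++ nseq (d - size zs) 0), e; split.
- by rewrite size_cat size_nseq subnKC.
- move=> z; rewrite mem_cat => /orP[/mzs //|/nseqP[-> _]]; exact: ideal_0.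
apply: subset_trans hz (ideal_mul_mono _ _) => //.
by rewrite adjoins_cat; apply: sub_adjoins.
Qed.

(** The new elements agree with the old ones modulo m^2, so m^(e+1) lies in J m^e + m m^(e+1), and
    Nakayama applies again. *)
Lemma exists_regular_reduction (gs : seq A) : regular_mod [set 0] xs ->
  m = adjoins [set 0] gs -> (w ^ size gs <= D)%N ->
  (forall r, (d < r <= size gs)%N -> ((r * w) ^ d * L < w ^ r)%N) ->
  exists zs e, [/\ size zs = d, forall z, z \in zs -> m z, regular_mod [set 0] zs &
    m ^** e.+1 `<=` ideal_mul (adjoins [set 0] zs) (m ^** e)].
Proof.
move=> hxs Em hD hr; have [ys [e [sys mys hys]]] := exists_reduction Em hD hr.
have [zs [szs hzs] hz] := regular_mod_perturb m_ideal m_proper m_unit nA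
  (@ideal_set0 A) sys mxs mys hxs.
have mzs z : z \in zs -> m z.
  by move=> /(nthP 0)[i hi <-]; have [] := hz i; rewrite -?szs.
exists zs, e; split=> //; first by rewrite szs.
set J := adjoins [set 0] zs.
have hJ : is_ideal J by apply/adjoins_ideal/ideal_set0.
have hI := ideal_mul_ideal J (m ^** e).
apply: (nakayama m_ideal m_proper m_unit nA hI (ideal_exp_ideal _ _)).
apply: subset_trans hys _.
have hT : is_ideal (ideal_add (ideal_mul J (m ^** e)) (ideal_mul m (m ^** e.+1))).
  by apply: ideal_add_ideal => //; apply: ideal_mul_ideal.
apply: ideal_mul_min => // y b + mb; move: y.
apply: (adjoins_min (colon_ideal b hT)) => [_ ->|_ /(nthP 0)[i hi <-]].
  by rewrite /colon /= mul0r; apply: ideal_0.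
have [_ m2] := hz i hi; rewrite /colon /= -(subKr zs`_i ys`_i) mulrBl.
apply: ideal_B => //.
  apply: sub_ideal_addl; first exact: ideal_mul_ideal.
  apply: mem_ideal_mul => //; apply: mem_adjoins; first exact: ideal_set0.
  by apply: mem_nth; rewrite szs.
apply: sub_ideal_addr => //; exact: (@ideal_exp_M _ _ 2 e).
Qed.

End Reduce.
End Reductions.

(** * Systems of parameters *)

(** A positive value is not the default 0, so the maximum is attained; this gives access to the
    dimension and the depth. *)
Lemma nat_max_gt0 (P : set nat) n : nat_max P = n -> (0 < n)%N ->
  P n /\ forall k, P k -> (k <= n)%N.
Proof.
rewrite /nat_max; set Q := [set _ | _] => E n0.
have [ex|nex] := pselect (exists k, Q k); first by rewrite -E; apply: xgetPex ex.
by move: n0; rewrite -E xgetPN // => k Qk; apply: nex; exists k.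
Qed.

Section Primes.
Variable A : comNzRingType.
Hypothesis nA : noetherian A.
Implicit Types (I P Q T : set A).

Lemma noetherian_max (F : set (set A)) I : (forall J, F J -> is_ideal J) -> F I ->
  exists2 Q, F Q & forall J, F J -> Q `<=` J -> J `<=` Q.
Proof.
move=> hF FI; apply: contrapT => h.
have /choice[g hg] : forall Q : {Q | F Q}, exists J : {J | F J},
    sval Q `<=` sval J /\ ~ (sval J `<=` sval Q).
  move=> [Q FQ]; apply: contrapT => hQ; apply: h; exists Q => // J FJ QJ.
  by apply: contrapT => nJ; apply: hQ; exists (exist _ J FJ).
pose c n := sval (iter n g (exist _ I FI)).
have [||N] := @acc A c nA.
- by move=> n; apply/hF/(svalP (iter n g _)).
- by move=> n; have [] := hg (iter n g (exist _ I FI)).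
by have [] := hg (iter N g (exist _ I FI)).
Qed.

Lemma is_prime_idealP P : is_prime_ideal P <->
  [/\ is_ideal P, ~ P 1 & forall u v, P (u * v) -> P u \/ P v].
Proof.
split=> -[h1 h2 h3]; split=> // u v.
  by move=> /mem_set/h3/orP[] /set_mem; [left|right].
by move=> /set_mem/h3 h; apply/orP; case: h => /mem_set; [left|right].
Qed.

(** An ideal maximal among those that contain I and are disjoint from the multiplicative set T is
    prime. *)
Lemma prime_avoiding I T : is_ideal I -> T 1 ->
  (forall a b, T a -> T b -> T (a * b)) -> (forall a, I a -> ~ T a) ->
  exists P, [/\ is_prime_ideal P, I `<=` P & forall a, P a -> ~ T a].
Proof.
move=> hI T1 TM IT.
have [||P [hP IP PT] mP] := @noetherian_max
   [set J | [/\ is_ideal J, I `<=` J & forall a, J a -> ~ T a]] I.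
- by move=> J [].
- by split.
exists P; split=> //; apply/is_prime_idealP; split=> //; first by move=> /PT.
have meets u : ~ P u -> exists2 t, T t & adjoin P u t.
  move=> nu; apply: contrapT => h; apply: nu.
  suff : adjoin P u `<=` P by apply; apply: mem_adjoin.
  apply: mP; last exact: sub_adjoin.
  split; [exact: adjoin_ideal|exact: subset_trans (@sub_adjoin _ _ _)|].
  by move=> a Pa Ta; apply: h; exists a.
move=> u v uv; apply: contrapT => /not_orP[/meets[t Tt [a Pa]] /meets[r Tr [b Pb]]].
apply: (PT (t * r)); last exact: TM.
have -> : t * r = (t - a * u) * r + (a * u) * (r - b * v) + a * b * (u * v) by ring.
apply: (ideal_D hP); last exact: ideal_Ml.
by apply: (ideal_D hP); [apply: ideal_Mr|apply: ideal_Ml].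
Qed.

Lemma regular_mod_prime_chain (xs : seq A) Q : regular_mod [set 0] xs -> is_prime_ideal Q ->
  adjoins [set 0] xs `<=` Q ->
  exists2 c : nat -> set A, c (size xs) = Q &
    (forall i, (i <= size xs)%N -> is_prime_ideal (c i)) /\
    (forall i, (i < size xs)%N -> c i `<` c i.+1).
Proof.
elim/last_ind: xs Q => [|xs x IH] Q; first by move=> _ hQ _; exists (fun _ => Q).
move=> /regular_mod_rcons[hxs hx] pQ; rewrite adjoins_rcons => xQ.
have /is_prime_idealP[hQ Q1 QM] := pQ.
have hI : is_ideal (adjoins [set 0] xs) by apply/adjoins_ideal/ideal_set0.
have Qx : Q x by apply/xQ/mem_adjoin.
(* A prime avoiding this set lies inside Q and misses x, as after localizing at Q and inverting x.
   The set misses the ideal of [xs], because x cancels modulo that ideal and Q contains it. *)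
have [|||P [pP IP PT]] := @prime_avoiding (adjoins [set 0] xs)
    [set y | exists s k, ~ Q s /\ y = s * x ^+ k] hI.
- by exists 1, 0%N; rewrite mulr1.
- move=> _ _ [s [k [Qs ->]]] [r [l [Qr ->]]]; exists (s * r), (k + l)%N.
  by split; [move=> /QM[]|rewrite exprD mulrACA].
- move=> a Ia [s [k [Qs E]]]; apply: Qs; apply/xQ/sub_adjoin.
  by apply: (@nonzerodivisor_X _ _ x k hx); rewrite mulrC -E.
have PQ : P `<=` Q.
  move=> y Py; apply: contrapT => nQ; apply: (PT y Py).
  by exists y, 0%N; rewrite mulr1.
have nPx : ~ P x.
  by move=> Px; apply: (PT x Px); exists 1, 1%N; rewrite mul1r.
have [c cE [c1 c2]] := IH P hxs pP IP.
exists (fun i => if (i <= size xs)%N then c i else Q); rewrite size_rcons ?ltnn //.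
split=> i hi; first by case: leqP => // h; apply: c1.
rewrite -ltnS hi; move: hi; rewrite ltnS leq_eqVlt => /orP[/eqP ->|hi].
  by rewrite ltnn cE; split=> // /(_ x Qx).
by rewrite hi; apply: c2.
Qed.

End Primes.

Section LocalRing.
Variables (A : comNzRingType) (m : set A).
Hypotheses (nA : noetherian A) (lA : is_local m).

Lemma local_ideal : is_ideal m. Proof. by have [[]] := lA. Qed.

Lemma local_proper : ~ m 1. Proof. by have [[]] := lA. Qed.

Lemma local_unit a : ~ m a -> exists b, a * b = 1.
Proof.
move=> na; apply: contrapT => nb; apply: na.
have n1 : ~ adjoin [set 0] a 1.
  by move=> [b /= /eqP]; rewrite subr_eq0 => /eqP E; apply: nb; exists b; rewrite mulrC.
have [||Q [hQ Q1 aQ] mQ] := @noetherian_max A nA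
   [set J | [/\ is_ideal J, ~ J 1 & adjoin [set 0] a `<=` J]] (adjoin [set 0] a).
- by move=> J [].
- by split=> //; apply/adjoin_ideal/ideal_set0.
suff <- : Q = m by apply: aQ; apply/mem_adjoin/ideal_set0.
apply: lA.2; split=> // J hJ J1 QJ; apply/seteqP; split=> //.
by apply: mQ => //; split=> //; apply: subset_trans QJ.
Qed.

Lemma local_prime : is_prime_ideal m.
Proof.
apply/is_prime_idealP; split; [exact: local_ideal|exact: local_proper|].
move=> u v uv; have [mv|nv] := pselect (m v); first by right.
by left; apply: (max_prime local_ideal local_unit uv).
Qed.

Lemma regular_mod_primary (xs : seq A) : (forall x, x \in xs -> m x) ->
  regular_mod [set 0] xs -> size xs = krull_dim A -> (0 < krull_dim A)%N ->
  exists N, m ^** N `<=` adjoins [set 0] xs.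
Proof.
move=> mxs hxs sxs d0; set J := adjoins [set 0] xs.
have hJ : is_ideal J by apply/adjoins_ideal/ideal_set0.
have [_ dmax] := nat_max_gt0 (erefl (krull_dim A)) d0.
(* A prime over J other than m would have a chain of d steps below it, and putting m on top would
   exceed the dimension. *)
have prime_m P : is_prime_ideal P -> J `<=` P -> m `<=` P.
  move=> pP JP; apply: contrapT => nmP.
  have [c cE [c1 c2]] := regular_mod_prime_chain nA hxs pP JP.
  have Pm : P `<=` m.
    by have [hP P1 _] := pP; apply: (sub_max local_unit hP).
  suff : chain_length (@is_prime_ideal A) (size xs).+1.
    by move=> /dmax; rewrite sxs ltnn.
  exists (fun i => if (i <= size xs)%N then c i else m); split=> i hi.
    by case: leqP => h; [apply: c1|apply: local_prime].
  rewrite -ltnS hi; move: hi; rewrite ltnS leq_eqVlt => /orP[/eqP ->|hi].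
    by rewrite ltnn cE.
  by rewrite hi; apply: c2.
have rad y : m y -> exists k, J (y ^+ k).
  move=> my; apply: contrapT => h.
  have [||| P [pP JP PT]] := @prime_avoiding A nA J [set z | exists k, z = y ^+ k] hJ.
  - by exists 0%N.
  - by move=> _ _ [k ->] [l ->]; exists (k + l)%N; rewrite exprD.
  - by move=> z Jz [k E]; apply: h; exists k; rewrite -E.
  by apply: (PT y); [apply: (prime_m P)|exists 1%N].
have [gs Em] := noetherian_adjoins nA local_ideal.
have [K K0 hK] : exists2 K, (0 < K)%N & forall g, g \in gs -> J (g ^+ K).
  have : forall g, g \in gs -> m g.
    by move=> g h; rewrite Em; apply: mem_adjoins h; apply: ideal_set0.
  elim: gs {Em} => [|g gs IH] h; first by exists 1%N.
  have [|K K0 hK] := IH; first by move=> x hx; apply: h; rewrite inE hx orbT.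
  have [k hk] := rad g (h g (mem_head _ _)).
  exists (K + k)%N; first by rewrite addn_gt0 K0.
  move=> x; rewrite inE => /orP[/eqP ->|/hK Jx]; rewrite exprD.
    exact: ideal_Ml.
  exact: ideal_Mr.
(* A monomial of this degree in [gs] has an exponent of at least K: the box contains no vector of
   sum n or more. *)
pose n := (size gs * K.-1).+1; exists n; rewrite {1}Em.
apply: subset_trans (ideal_exp_box_ideal K0 (n := n)) _.
have E : [seq a <- box (size gs) K | (n <= sumn a)%N] = [::].
  apply/eqP; rewrite -(negbK (_ == _)) -has_filter; apply/hasPn => a /sumn_box.
  by rewrite -leqNgt.
rewrite /box_ideal E /=; apply: adjoins_min => // [_ ->|_ /mapP[g /hK h ->] //].
exact: ideal_0.
Qed.

End LocalRing.

Lemma cohen_macaulay_parameters (A : comNzRingType) (m : set A) :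
  noetherian A -> is_local m -> cohen_macaulay m -> (0 < krull_dim A)%N ->
  exists xs : seq A, [/\ size xs = krull_dim A, forall x, x \in xs -> m x,
    regular_mod [set 0] xs & exists N, m ^** N `<=` adjoins [set 0] xs].
Proof.
move=> nA lA cA d0; have [[xs [sxs mxs /regular_sequence_regular_mod hxs]] _] := nat_max_gt0 cA d0.
by exists xs; split=> //; apply: regular_mod_primary.
Qed.

(** * Extension of the residue field *)

Section Coefficients.
Variables (R : comNzRingType).
Implicit Types (a : set R) (p q g : {poly R}).

Definition coefs_in a : set {poly R} := [set p | forall k, a p`_k].

Lemma coefs_in_ideal a : is_ideal a -> is_ideal (coefs_in a).
Proof.
move=> ha; apply/is_idealP; split=> [k|u p q hp hq k]; first by rewrite coef0; apply: ideal_0.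
rewrite coefD coefM; apply: ideal_D => //; apply: ideal_sum => // i _.
exact: ideal_Ml.
Qed.

Lemma coefs_in_adjoin a x p : is_ideal a ->
  coefs_in (adjoin a x) p <-> adjoin (coefs_in a) x%:P p.
Proof.
move=> ha; split=> [hp|[q hq] k].
  have /choice[c hc] : forall k, exists c, a (p`_k - c * x) by move=> k; apply: hp.
  exists (\poly_(k < size p) c k) => k; rewrite coefB coefMC coef_poly.
  case: ltnP => // /leq_sizeP/(_ k (leqnn k)) ->.
  by rewrite mul0r subrr; apply: ideal_0.
by exists q`_k; have := hq k; rewrite coefB coefMC.
Qed.

Section Division.
Variable f : {poly R}.
Hypothesis f_monic : f \is monic.

Lemma monic_division p : exists q, (size (p - q * f)%R < size f)%N.
Proof.
exists (Pdiv.CommonRing.rdivp p f).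
rewrite {1}(Pdiv.RingMonic.rdivp_eq f_monic p) addrC addKr.
by apply: Pdiv.CommonRing.ltn_rmodpN0; apply: monic_neq0.
Qed.

(** The remainder by a monic polynomial is R-linear, so that of p combines remainders of powers of X
    with coefficients in a. *)
Lemma coefs_in_division a p : is_ideal a -> coefs_in a p ->
  exists q, (size (p - q * f)%R < size f)%N /\ coefs_in a (p - q * f).
Proof.
move=> ha hp; exists (Pdiv.CommonRing.rdivp p f).
rewrite {1 3}(Pdiv.RingMonic.rdivp_eq f_monic p) addrC addKr.
split; first by apply: Pdiv.CommonRing.ltn_rmodpN0; apply: monic_neq0.
move=> k; rewrite -[p]coefK poly_def Pdiv.RingMonic.rmodp_sum // coef_sum.
apply: ideal_sum => // i _; rewrite Pdiv.RingMonic.rmodpZ // coefZ.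
by apply: ideal_Mr => //; apply: hp.
Qed.

(* The powers of X below the degree of f are independent over every quotient
   of R. *)
Lemma coefs_in_small a p g : is_ideal a -> (size p < size f)%N ->
  coefs_in a (p - g * f) -> coefs_in a p.
Proof.
move=> ha sp hp; have [q [sq hq]] := coefs_in_division ha hp.
move: sq hq; rewrite -addrA -opprD -mulrDl; have [->|nz] := eqVneq (g + q) 0.
  by rewrite mul0r subr0.
rewrite addrC; have sgf : (size f <= size ((g + q) * f)%R)%N.
  by rewrite size_Mmonic //; move: nz; rewrite -size_poly_gt0; lia.
by rewrite size_polyDl size_polyN ?(leq_trans sp) // ltnNge sgf.
Qed.

End Division.

Section ResidueExtension.
Variables (m : set R).
Hypothesis m_ideal : is_ideal m.
Hypothesis m_unit : forall x, ~ m x -> exists y, x * y = 1.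

Let mP := coefs_in m.
Let mP_ideal : is_ideal mP := coefs_in_ideal m_ideal.

(** Leading terms with coefficient in m are dropped until a unit leads, and this unit is divided
    out. *)
Lemma monic_mod_max p : ~ mP p ->
  exists2 r, r \is monic /\ (size r <= size p)%N & exists b, mP (b%:P * p - r).
Proof.
have [n] := ubnP (size p); elim: n p => // n IH p sp np.
have [mp|nmp] := pselect (m (lead_coef p)).
  pose p' := p - lead_coef p *: 'X^((size p).-1).
  have p0 : p != 0.
    by apply/eqP => E; apply: np => k; rewrite E coef0; apply: ideal_0.
  have sp' : (size p' < size p)%N.
    rewrite -(prednK (n := size p)) ?size_poly_gt0 // ltnS.
    apply/leq_sizeP => j hj; rewrite coefB coefZ coefXn.
    move: hj; rewrite leq_eqVlt => /orP[/eqP <-|hj].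
      by rewrite eqxx mulr1 lead_coefE subrr.
    rewrite gtn_eqF // mulr0 subr0; apply: (leq_sizeP _ _ (leqnn (size p))).
    by lia.
  have hpp : mP (p - p').
    rewrite /p' opprB addrC subrK => k; rewrite coefZ; exact: ideal_Mr.
  have [|| r [r1 r2] [b hb]] := IH p'; first by lia.
    by move=> h; apply: np; rewrite -(subrK p' p); apply: (ideal_D mP_ideal).
  exists r; first by split=> //; apply: leq_trans r2 (ltnW sp').
  exists b; have -> : b%:P * p - r = b%:P * (p - p') + (b%:P * p' - r) by ring.
  by apply: (ideal_D mP_ideal) => //; apply: (ideal_Ml mP_ideal).
have [b hb] := m_unit nmp.
have bl : b * lead_coef p = 1 by rewrite mulrC.
have sb : size (b%:P * p) = size p.
  rewrite mul_polyC lreg_size // => x y /(congr1 ( *%R (lead_coef p))).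
  by rewrite !mulrA hb !mul1r.
exists (b%:P * p).
  by rewrite monicE lead_coefE sb coefCM -lead_coefE bl.
by exists b => k; rewrite subrr coef0; apply: ideal_0.
Qed.

(** Euclid's argument in (R/m)[X], carried out over R: f is a nonconstant monic divisor of h modulo
    m of least degree. *)
Lemma irreducible_factor (h : {poly R}) : h \is monic -> (1 < size h)%N ->
  exists f, [/\ f \is monic, (1 < size f)%N, adjoin mP f h &
    forall p, ~ adjoin mP f p -> exists u, adjoin mP f (p * u - 1)].
Proof.
move=> h_monic h_size.
pose good n := `[< exists f, [/\ f \is monic, (1 < size f)%N, adjoin mP f h & size f = n] >].
have ex : exists n, good n.
  exists (size h); apply/asboolP; exists h; split=> //; exact: mem_adjoin.
case: (ex_minnP ex) => _ /asboolP[f [fm fs fh <-]] minf.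
exists f; split=> // p np.
set I := adjoin (adjoin mP f) p.
have hMf : is_ideal (adjoin mP f) by apply: adjoin_ideal.
have hI : is_ideal I by apply: adjoin_ideal.
have mPI : mP `<=` I by apply: subset_trans (@sub_adjoin _ _ _) (@sub_adjoin _ _ _).
(* A monic f' of least degree in (m, f, p) generates this ideal modulo m: it is a greatest common
   divisor of f and p. *)
pose goodI n := `[< exists f', [/\ f' \is monic, I f' & size f' = n] >].
have exI : exists n, goodI n.
  by exists (size f); apply/asboolP; exists f; split=> //; apply/sub_adjoin/mem_adjoin.
case: (ex_minnP exI) => _ /asboolP[f' [f'm f'I <-]] minf'.
have small r : I r -> (size r < size f')%N -> mP r.
  move=> Ir sr; apply: contrapT => /monic_mod_max[r' [r'm r's] [b hb]].
  have : goodI (size r').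
    apply/asboolP; exists r'; split=> //.
    rewrite -(subKr (b%:P * r) r'); apply: (ideal_B hI); first exact: ideal_Ml.
    exact: mPI.
  by move=> /minf'; rewrite leqNgt (leq_ltn_trans r's).
have If : I `<=` adjoin mP f'.
  move=> g Ig; have [q sq] := monic_division f'm g.
  exists q; apply: small => //; apply: (ideal_B hI) => //; exact: ideal_Ml.
have [s1|s1] := leqP (size f') 1.
  have E : f' = 1.
    have := size1_polyC s1; move: (f'm); rewrite monicE lead_coefE.
    have : (0 < size f')%N by rewrite size_poly_gt0 monic_neq0.
    by case: (size f') s1 => [//|[|//]] _ _ /= /eqP -> ->.
  have [u hu] : I 1 by rewrite -E.
  exists u; rewrite mulrC; apply: (ideal_BC hMf); exact: hu.
(* A nonconstant f' divides h modulo m, so minimality of f forces equal degrees; then f and f' agree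
   modulo m, and p lies in (m, f). *)
case: np; have sff' : size f' = size f.
  apply/eqP; rewrite eqn_leq minf' /=; last first.
    by apply/asboolP; exists f; split=> //; apply/sub_adjoin/mem_adjoin.
  apply: minf; apply/asboolP; exists f'; split=> //.
  have : adjoin mP f `<=` adjoin mP f'.
    by apply: subset_trans If; apply: sub_adjoin.
  exact.
have ff' : mP (f - f').
  apply: small.
    by apply: (ideal_B hI) => //; apply/sub_adjoin/mem_adjoin.
  have sf0 : (0 < size f')%N by lia.
  rewrite -[X in (_ < X)%N](prednK sf0) ltnS; apply/leq_sizeP => j.
  rewrite leq_eqVlt => /orP[/eqP <-|hj].
    rewrite coefB {1}sff' -!lead_coefE (monicP fm) (monicP f'm) subrr //.
  have hj' : (size f' <= j)%N by rewrite -(prednK sf0).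
  by rewrite coefB (nth_default 0 hj') nth_default ?subrr // -sff'.
suff : adjoin mP f' `<=` adjoin mP f.
  by apply; apply: If; apply: mem_adjoin.
apply: adjoin_min => //; first exact: sub_adjoin.
rewrite -(subKr f f'); apply: (ideal_B hMf); first exact: mem_adjoin.
exact: sub_adjoin.
Qed.

End ResidueExtension.
End Coefficients.

(** The Hilbert basis argument in bounded degree: generators of the ideal of coefficients at X^n are
    lifted, and induction treats the elements where that coefficient vanishes. *)
Lemma bounded_submod_fg (R : comNzRingType) n (N : set {poly R}) :
  noetherian R -> is_submod N -> (forall p, N p -> (size p <= n)%N) ->
  exists2 ps : seq {poly R}, (forall p, p \in ps -> N p) &
    forall L : set {poly R}, is_submod L -> (forall p, p \in ps -> L p) -> N `<=` L.
Proof.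
move=> nR; elim: n N => [|n IH] N /is_submodP[N0 NL] hN.
  exists [::] => // L /is_submodP[L0 _] _ p /hN.
  by rewrite leqn0 size_poly_eq0 => /eqP ->.
have NZ c p : N p -> N (c *: p).
  by move=> Np; rewrite -[c *: p]addr0; apply: NL.
have NB p q : N p -> N q -> N (p - q).
  by move=> Np Nq; rewrite addrC -scaleN1r; apply: NL.
pose N' := [set p | N p /\ (size p <= n)%N].
have [||ps' hps' gen'] := IH N'.
- apply/is_submodP; split; first by split=> //; rewrite size_poly0.
  move=> c p q [Np sp] [Nq sq]; split; first exact: NL.
  rewrite (leq_trans (size_polyD _ _)) // geq_max sq andbT.
  exact: leq_trans (size_scale_leq _ _) sp.
- by move=> p [].
pose C := [set c | exists2 p, N p & p`_n = c].
have hC : is_ideal C.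
  apply/is_idealP; split; first by exists 0; rewrite ?coef0.
  move=> c _ _ [p Np <-] [q Nq <-]; exists (c *: p + q); first exact: NL.
  by rewrite coefD coefZ.
have [cs Ecs] := noetherian_adjoins nR hC.
have [ps Eps hps] : exists2 ps, [seq p`_n | p : {poly R} <- ps] = cs &
    forall p, p \in ps -> N p.
  have : forall c, c \in cs -> C c.
    by move=> c h; rewrite Ecs; apply: mem_adjoins h; apply: ideal_set0.
  elim: cs {Ecs} => [|c cs IHc] h; first by exists [::].
  have [|ps <- hps] := IHc; first by move=> x hx; apply: h; rewrite inE hx orbT.
  have [p Np Ep] := h c (mem_head _ _).
  exists (p :: ps); first by rewrite /= Ep.
  by move=> q; rewrite inE => /orP[/eqP -> //|/hps].
exists (ps ++ ps') => [p|L hL hLp p Np].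
  by rewrite mem_cat => /orP[/hps|/hps'[]].
have /is_submodP[L0 LL] := hL.
have hI : is_ideal [set c | exists p, [/\ N p, L p & p`_n = c]].
  apply/is_idealP; split; first by exists 0; rewrite coef0.
  move=> c _ _ [q [Nq Lq <-]] [r [Nr Lr <-]]; exists (c *: q + r).
  by split; [exact: NL|exact: LL|rewrite coefD coefZ].
have [q [Nq Lq Eq]] : [set c | exists p, [/\ N p, L p & p`_n = c]] p`_n.
  have : C p`_n by exists p.
  rewrite Ecs; apply: (adjoins_min hI) => [_ ->|c]; first exact: (ideal_0 hI).
  rewrite -Eps => /mapP[q hq ->]; exists q; split=> //; first exact: hps.
  by apply: hLp; rewrite mem_cat hq.
rewrite -(subrK q p) -[p - q]scale1r; apply: LL => //.
apply: (gen' L) => // [r hr|]; first by apply: hLp; rewrite mem_cat hr orbT.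
split; first exact: NB.
apply/leq_sizeP => j; rewrite leq_eqVlt => /orP[/eqP <-|hj].
  by rewrite coefB Eq subrr.
by rewrite coefB !nth_default ?subrr //; apply: leq_trans hj; apply: hN.
Qed.

(** * The extension S = R[X]/(f) for a monic f *)

Section MonicExtension.
Variables (R S : comNzRingType) (phi : {rmorphism {poly R} -> S}) (f : {poly R}).
Hypotheses (f_monic : f \is monic) (f_size : (1 < size f)%N).
Hypothesis phi_surj : forall s, exists p, phi p = s.
Hypothesis phi_ker : forall p, phi p = 0 <-> exists q, p = q * f.
Implicit Types (a : set R) (x : R) (p q : {poly R}) (s : S).

Definition extended a : set S := [set s | exists2 p, coefs_in a p & phi p = s].

Lemma phi_repr s : exists2 p : {poly R}, (size p < size f)%N & phi p = s.
Proof.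
have [p <-] := phi_surj s; have [q hq] := monic_division f_monic p.
exists (p - q * f) => //; rewrite rmorphB /= (_ : phi (q * f) = 0) ?subr0 //.
by apply/phi_ker; exists q.
Qed.

(** S is free over R on the powers of X below the degree of f, so membership in a S is read off the
    coefficients of the small representative. *)
Lemma extended_small a p : is_ideal a -> (size p < size f)%N -> extended a (phi p) ->
  coefs_in a p.
Proof.
move=> ha sp [q hq /eqP]; rewrite -subr_eq0 -rmorphB /= => /eqP/phi_ker[g E].
apply: (coefs_in_small f_monic ha sp (g := - g)).
by rewrite mulNr -E addrC opprK subrK.
Qed.

Lemma extended_ideal a : is_ideal a -> is_ideal (extended a).
Proof.
move=> ha; have hc := coefs_in_ideal ha; apply/is_idealP; split.
  by exists 0; [apply: ideal_0|rewrite rmorph0].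
move=> c _ _ [p hp <-] [q hq <-]; have [r <-] := phi_surj c.
exists (r * p + q); last by rewrite rmorphD rmorphM.
by apply: (ideal_D hc) => //; apply: (ideal_Ml hc).
Qed.

Lemma extended_0 : extended [set 0] = [set 0].
Proof.
apply/seteqP; split=> [_ [p hp <-]|_ ->].
  by rewrite (_ : p = 0) ?rmorph0 //; apply/polyP => k; rewrite hp coef0.
by exists 0; [move=> k; rewrite coef0|rewrite rmorph0].
Qed.

Lemma extended_mono a b : a `<=` b -> extended a `<=` extended b.
Proof. by move=> ab _ [p hp <-]; exists p => // k; apply: ab. Qed.

Lemma mem_ext a x : is_ideal a -> a x -> extended a (phi x%:P).
Proof.
move=> ha ax; exists x%:P => // k; rewrite coefC; case: eqP => // _.
exact: ideal_0.
Qed.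

Lemma extended_adjoin a x : is_ideal a -> extended (adjoin a x) = adjoin (extended a) (phi x%:P).
Proof.
move=> ha; apply/seteqP; split=> [_ [p /(coefs_in_adjoin _ _ ha)[q hq] <-]|].
  by exists (phi q); rewrite -rmorphM -rmorphB; exists (p - q * x%:P).
apply: adjoin_min; [exact/extended_ideal/adjoin_ideal|exact/extended_mono/sub_adjoin|].
by apply: mem_ext; [apply: adjoin_ideal|apply: mem_adjoin].
Qed.

Lemma extended_adjoins a xs : is_ideal a ->
  extended (adjoins a xs) = adjoins (extended a) [seq phi x%:P | x <- xs].
Proof.
elim: xs a => //= x xs IH a ha; rewrite IH; last exact: adjoin_ideal.
by rewrite extended_adjoin.
Qed.

Lemma extended_min a (K : set S) : is_ideal K -> (forall x, a x -> K (phi x%:P)) ->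
  extended a `<=` K.
Proof.
move=> hK h _ [p hp <-]; rewrite -[p]coefK poly_def rmorph_sum /=.
apply: ideal_sum => // i _; rewrite -mul_polyC rmorphM; apply: ideal_Mr => //.
by apply: h; apply: hp.
Qed.

Lemma extended_nonzerodivisor a x : is_ideal a -> nonzerodivisor a x -> nonzerodivisor (extended a) (phi x%:P).
Proof.
move=> ha hx s; have [p sp <-] := phi_repr s; rewrite -rmorphM mul_polyC => h.
exists p => // k; apply: hx; rewrite -coefZ; apply: (extended_small ha _ h).
exact: leq_ltn_trans (size_scale_leq _ _) sp.
Qed.

Lemma extended_regular_mod a xs : is_ideal a -> regular_mod a xs ->
  regular_mod (extended a) [seq phi x%:P | x <- xs].
Proof.
elim: xs a => //= x xs IH a ha [h1 h2]; split; first exact: extended_nonzerodivisor.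
by rewrite -extended_adjoin //; apply: IH => //; apply: adjoin_ideal.
Qed.

Lemma extended_noetherian : noetherian R -> noetherian S.
Proof.
move=> nR I hI.
pose N := [set p : {poly R} | (size p <= size f)%N /\ I (phi p)].
have [||ps hps gen] := @bounded_submod_fg R (size f) N nR.
- apply/is_submodP; split; first by rewrite /N /= size_poly0 rmorph0; split=> //; apply: ideal_0.
  move=> c p q [sp Ip] [sq Iq]; split.
    rewrite (leq_trans (size_polyD _ _)) // geq_max sq andbT.
    exact: leq_trans (size_scale_leq _ _) sp.
  rewrite rmorphD -mul_polyC rmorphM; apply: ideal_D => //; exact: ideal_Ml.
- by move=> p [].
exists [seq phi p | p <- ps].
rewrite -/(ideal_span _) ideal_span_adjoins.
have hA : is_ideal (adjoins [set 0] [seq phi p | p <- ps]).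
  exact/adjoins_ideal/ideal_set0.
apply/seteqP; split.
  apply: adjoins_min => // [_ ->|_ /mapP[p /hps[_ Ip] ->] //]; exact: ideal_0.
move=> s Is; have [p sp Ep] := phi_repr s; rewrite -Ep.
apply: (gen [set p | adjoins [set 0] [seq phi p | p <- ps] (phi p)]) => /=.
- apply/is_submodP; split=> /=; first by rewrite rmorph0; apply: ideal_0.
  move=> c q r hq hr; rewrite rmorphD -mul_polyC rmorphM.
  by apply: ideal_D => //; apply: ideal_Ml.
- by move=> q hq; apply: mem_adjoins; [apply: ideal_set0|apply: map_f].
- by split; [apply: ltnW|rewrite Ep].
Qed.

Section LocalExtension.
Variable m : set R.
Hypotheses (m_ideal : is_ideal m) (m_proper : ~ m 1).
Hypothesis m_unit : forall x, ~ m x -> exists y, x * y = 1.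
Hypothesis nR : noetherian R.
Hypothesis f_irr : forall p, ~ adjoin (coefs_in m) f p ->
  exists u, adjoin (coefs_in m) f (p * u - 1).

Lemma extended_max p : extended m (phi p) <-> adjoin (coefs_in m) f p.
Proof.
split=> [[q hq /eqP]|[q hq]].
  rewrite -subr_eq0 -rmorphB => /eqP/phi_ker[g E]; exists (- g).
  by rewrite mulNr -E opprK addrC subrK.
exists (p - q * f) => //; rewrite rmorphB /= (_ : phi (q * f) = 0) ?subr0 //.
by apply/phi_ker; exists q.
Qed.

Lemma extended_proper : ~ extended m 1.
Proof.
rewrite -(rmorph1 phi) => h; apply: m_proper.
have := extended_small m_ideal _ h 0%N; rewrite coefC eqxx; apply.
by rewrite size_poly1.
Qed.

(* S is a finite R-module, hence m S lies in the Jacobson radical of S. *)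
Lemma extended_unit_1D v : extended m v -> exists w, (1 + v) * w = 1.
Proof.
move=> mv; pose I := [set p | exists w, phi p = (1 + v) * w].
have hI : @is_submod R {poly R} I.
  apply/is_submodP; split; first by exists 0; rewrite rmorph0 mulr0.
  move=> c p q [w Ew] [w' Ew']; exists (phi c%:P * w + w').
  by rewrite rmorphD -mul_polyC rmorphM Ew Ew'; ring.
suff [w Ew] : I 1 by exists w; rewrite -Ew rmorph1.
pose s := [seq 'X^i : {poly R} | i <- iota 0 (size f)].
have s1 : 1 \in s.
  by apply/mapP; exists 0%N; rewrite ?expr0 // mem_iota; lia.
move: 1 s1; apply: (nakayama_mod m_ideal m_proper m_unit hI) => p _.
have [r sr Er] := phi_repr (v * phi p).
have hr : coefs_in m r.
  by apply: extended_small => //; rewrite Er; apply: ideal_Mr => //; apply: extended_ideal.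
(* As r represents v p, the sum p + r is sent to (1 + v) p, so it lies in I. *)
exists (- r); last by exists (phi p); rewrite opprK rmorphD Er mulrDl mul1r.
exists (fun j => - r`_j); first by move=> j; apply: ideal_N => //; apply: hr.
rewrite size_map size_iota; apply/polyP => k; rewrite coefN coef_sum.
have [kf|fk] := ltnP k (size f).
  rewrite (bigD1 (Ordinal kf)) //= (nth_map 0%N) ?size_iota // nth_iota //.
  rewrite coefZ coefXn eqxx mulr1 big1 ?addr0 // => j nj.
  rewrite (nth_map 0%N) ?size_iota // nth_iota // coefZ coefXn.
  by rewrite -val_eqE /= in nj; rewrite add0n eq_sym (negbTE nj) mulr0.
rewrite nth_default ?oppr0; last exact: leq_trans (ltnW sr) fk.
rewrite big1 // => j _; rewrite (nth_map 0%N) ?size_iota // nth_iota // coefZ coefXn.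
by rewrite gtn_eqF ?mulr0 // add0n (leq_trans (ltn_ord j)).
Qed.

Lemma extended_unit s : ~ extended m s -> exists w, s * w = 1.
Proof.
have [p <-] := phi_surj s; move=> ns.
have [|u hu] := f_irr (p := p); first by move=> /extended_max.
have [w Ew] := extended_unit_1D ((extended_max _).2 hu).
exists (phi u * w); rewrite mulrA -rmorphM -Ew rmorphB rmorph1.
by rewrite addrCA subrr addr0.
Qed.

(** Extension to S does not increase length: along a composition series of R/a, each factor R/m
    becomes a quotient of S/mS, which is simple. *)
Lemma ideal_chain_ext a N k : is_ideal a -> m ^** N `<=` a ->
  ideal_chain (extended a) setT k -> ideal_chain a setT k.
Proof.
have [B hB] := length_le_exp m_unit N nR.
move=> ha mA; move: k; move: a ha mA.
apply: (@primary_ind _ _ (fun a => forall k, ideal_chain (extended a) setT k -> ideal_chain a setT k)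
  _ _ hB).
  move=> k h; suff : (k <= 0)%N.
    by rewrite leqn0 => /eqP ->; apply: ideal_chain0 => //; apply: ideal_setT.
  apply: (@length_le0 S setT); apply: ideal_chain_mono h => //.
  by move=> s _; have [p _ <-] := phi_repr s; exists p.
move=> a z ha mA nz mz IH k.
have sub : extended a `<=` extended (adjoin a z) by apply/extended_mono/sub_adjoin.
have hez : is_ideal (extended (adjoin a z)) by apply/extended_ideal/adjoin_ideal.
case/(ideal_chain_split hez (@ideal_setT S) sub) => // i [j [<- [hi hj]]].
have i1 : (i <= 1)%N.
  apply: (length_le_max extended_unit).
  move: hi; rewrite extended_adjoin //; apply: ideal_chain_adjoin; first exact: extended_ideal.
  move=> r; have hc := colon_ideal (phi z%:P) (extended_ideal ha).
  apply: (extended_min hc) => x mx; rewrite /colon /= -rmorphM -polyCM.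
  by apply: mem_ext => //; apply: mz.
have h1 : ideal_chain a (adjoin a z) 1.
  apply: ideal_chain1 => //; first exact: adjoin_ideal.
  by split; [apply: sub_adjoin|move=> h; apply: nz; apply: h; apply: mem_adjoin].
by apply: ideal_chain_cat (IH _ hj); apply: ideal_chain_leq i1 h1.
Qed.

End LocalExtension.
End MonicExtension.

Lemma in_qpoly_ker (R : comNzRingType) (f p : {poly R}) : f \is monic ->
  (1 < size f)%N -> in_qpoly f p = 0 <-> exists q, p = q * f.
Proof.
move=> fm fs; have E : mk_monic f = f by rewrite /mk_monic fm fs.
split=> [/(congr1 val) /= h|[q ->]].
  exists (Pdiv.CommonRing.rdivp p f).
  by move: h; rewrite E => h; rewrite {1}(Pdiv.RingMonic.rdivp_eq fm p) h addr0.
by apply/val_eqP; rewrite /= E Pdiv.RingMonic.rmodp_mull.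
Qed.

Lemma in_qpoly_surj (R : comNzRingType) (f : {poly R}) (s : {poly %/ f}) :
  exists p, in_qpoly f p = s.
Proof.
exists (val s); apply/val_inj; rewrite /= Pdiv.CommonRing.rmodp_small //.
exact: size_mk_monic.
Qed.

(* Every root of this polynomial in a field is nonzero and has order greater
   than D. *)
Definition large_order_poly (R : comNzRingType) D : {poly R} :=
  'X * \prod_(i < D) ('X^(i.+1) - 1) + 1.

Lemma large_order_polyP (R : comNzRingType) D :
  large_order_poly R D \is monic /\ (1 < size (large_order_poly R D))%N.
Proof.
rewrite /large_order_poly; set P := \prod_(i < D) _.
have mP : P \is monic.
  by apply: monic_prod => i _; rewrite -[1]/(1%:P) monicXnsubC.
have sXP : (1 < size ('X * P)%R)%N.
  by rewrite mulrC size_mulX ?monic_neq0 // ltnS size_poly_gt0 monic_neq0.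
have s1 : (size (1%R : {poly R}) < size ('X * P)%R)%N by rewrite size_poly1.
rewrite size_polyDl //; split=> //.
by rewrite monicE lead_coefDl // -monicE monicMl // monicX.
Qed.

(** If x^i and x^j agreed modulo m, cancelling x^i would put x^(j-i) - 1 in m; it divides the
    product, so 1 would lie in m. *)
Lemma large_order (A : comNzRingType) (m : set A) (x : A) D : is_ideal m ->
  ~ m 1 -> (forall a, ~ m a -> exists b, a * b = 1) ->
  m (x * \prod_(i < D) (x ^+ i.+1 - 1) + 1) ->
  forall i j, (i < j < D)%N -> ~ m (x ^+ j - x ^+ i).
Proof.
move=> hm m1 mu hx i j /andP[ij jD] h.
have nx : ~ m x.
  by move=> mx; apply: m1; apply: (ideal_Dl hm (v := x * \prod_(i < D) (x ^+ i.+1 - 1)));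
    rewrite 1?addrC //; apply: ideal_Mr.
have nX k : ~ m (x ^+ k).
  elim: k => [|k IH]; first by rewrite expr0.
  by rewrite exprS => /(max_prime hm mu)/(_ IH).
have hji : m (x ^+ (j - i) - 1).
  apply: (max_prime hm mu (b := x ^+ i)) => //.
  by rewrite mulrBl mul1r -exprD subnK // ltnW.
apply: m1.
have kD : ((j - i).-1 < D)%N by lia.
apply: (ideal_Dl hm (v := x * \prod_(i < D) (x ^+ i.+1 - 1))); first by rewrite addrC.
rewrite (bigD1 (Ordinal kD)) //= prednK ?subn_gt0 //.
by apply: ideal_Ml => //; apply: ideal_Mr.
Qed.

(** (r w)^d L <= mu^d L w^d < w^(d+1) <= w^r. *)
Lemma box_dominates d mu L w r : (mu ^ d * L < w)%N -> (d < r <= mu)%N ->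
  ((r * w) ^ d * L < w ^ r)%N.
Proof.
move=> hw /andP[dr rmu]; have w0 : (0 < w)%N by apply: leq_ltn_trans hw.
apply: (@leq_trans (w ^ d.+1)); last by rewrite leq_pexp2l.
rewrite expnMn mulnAC expnS ltn_pmul2r ?expn_gt0 ?w0 //.
apply: leq_ltn_trans hw; rewrite leq_mul2r; case: d {dr} => [|d]; first by rewrite orbT.
by rewrite leq_exp2r // rmu orbT.
Qed.

Theorem length_lower_bound (R : comNzRingType) (m : set R) (p : nat) :
  noetherian R -> is_local m -> cohen_macaulay m -> p \in [pchar R] ->
  (0 < krull_dim R)%N ->
  exists c, forall e n,
    ideal_chain (ideal_add (m ^** n) (frobenius_power m (p ^ e))) setT
        (box_count (krull_dim R) (p ^ e) (n - c)).
Proof.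
move=> nR lR cR pR d0.
have hm := local_ideal lR; have m1 := local_proper lR.
have mu := local_unit nR lR.
have [xs [sxs mxs hxs [N mN]]] := cohen_macaulay_parameters nR lR cR d0.
have hJ0 : is_ideal (adjoins [set 0] xs) by apply/adjoins_ideal/ideal_set0.
have [gs Em] := noetherian_adjoins nR hm.
have [L hL] := length_le_exp mu N nR.
have lxs : length_le (adjoins [set 0] xs) setT L by apply: length_le_mono hL.
(* This w satisfies [box_dominates] for every number of generators met on the way, and D values t_j
   suffice for every polynomial in [reduce_one]. *)
pose w := (size gs ^ size xs * L).+1.
pose D := (w ^ size gs)%N.
have [hmon hsz] := large_order_polyP R D.
have [f [fm fs fh firr]] := irreducible_factor hm mu hmon hsz.
pose phi : {rmorphism {poly R} -> {poly %/ f}} := in_qpoly f.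
have ker p' := in_qpoly_ker p' fm fs.
have surj := @in_qpoly_surj R f.
pose M := extended phi m.
have hM : is_ideal M by apply: extended_ideal.
have M1 : ~ M 1 by apply: (extended_proper fm fs ker hm m1).
have Mu a : ~ M a -> exists b, a * b = 1.
  exact: (extended_unit fm fs surj ker hm m1 mu firr).
have nS : noetherian {poly %/ f} by apply: (extended_noetherian fm surj ker nR).
have e0 := extended_0 phi.
pose xsS := [seq phi x%:P | x <- xs].
have mxsS x : x \in xsS -> M x.
  by move=> /mapP[y /mxs my ->]; apply: mem_ext.
have hxsS : regular_mod [set 0] xsS.
  rewrite -e0; apply: (extended_regular_mod fm surj ker) => //; exact: ideal_set0.
have lxsS : length_le (adjoins [set 0] xsS) setT L.
  move=> k; rewrite -e0 -extended_adjoins //; last exact: ideal_set0.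
  by move=> /(ideal_chain_ext fm fs surj ker hm m1 mu nR firr hJ0 mN)/lxs.
have EM : M = adjoins [set 0] [seq phi x%:P | x <- gs].
  by rewrite -e0 -extended_adjoins -?Em //; apply: ideal_set0.
have tsep i j : (i < j < D)%N -> ~ M (phi 'X ^+ j - phi 'X ^+ i).
  apply: large_order => //.
  have : M (phi (large_order_poly R D)) by apply/(extended_max ker).
  rewrite /large_order_poly rmorphD rmorphM rmorph_prod rmorph1.
  by under eq_bigr => k _ do rewrite rmorphB rmorphXn rmorph1.
have [||zs [c [szs mzs hzs hred]]] := exists_regular_reduction hM M1 Mu nS
  mxsS lxsS (ltn0Sn _ : (0 < w)%N) tsep hxsS EM.
- by rewrite size_map.
- by move=> r hr; apply: box_dominates hr; rewrite !size_map.
exists c => e n.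
have q0 : (0 < p ^ e)%N by rewrite expn_gt0 prime_gt0 // (pcharf_prime pR).
have frobD (x y : {poly %/ f}) : (x + y) ^+ (p ^ e) = x ^+ (p ^ e) + y ^+ (p ^ e).
  apply: exprDn_pchar; rewrite pnatX pnatE ?(pcharf_prime pR) //.
  by apply/orP; left; apply: (rmorph_pchar phi); rewrite pchar_poly.
have := ideal_chain_box hM M1 Mu nS q0 frobD n mzs hzs hred.
rewrite szs size_map sxs => h.
set a := ideal_add _ _.
have ha : is_ideal a.
  by apply: ideal_add_ideal; [apply: ideal_exp_ideal|apply: frobenius_ideal].
(* Back from S to R: the extension of m^n + m^[q] lies in M^n + M^[q], so the chain found over S
   lies above it. *)
apply: (ideal_chain_ext fm fs surj ker hm m1 mu nR firr ha (N := n)).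
  by apply: sub_ideal_addl; apply: frobenius_ideal.
apply: ideal_chain_mono h => //.
set b := ideal_add _ _.
have hb : is_ideal b.
  by apply: ideal_add_ideal; [apply: ideal_exp_ideal|apply: frobenius_ideal].
have contr (I : set {poly %/ f}) : is_ideal I -> is_ideal [set x | I (phi x%:P)].
  move=> hI; apply/is_idealP; split=> /=; first by rewrite polyC0 rmorph0; apply: ideal_0.
  move=> u v v' Iv Iv'; rewrite polyCD polyCM rmorphD rmorphM.
  by apply: ideal_D => //; apply: ideal_Ml.
apply: extended_min => //; apply: (ideal_add_min (contr _ hb)).
  have hexp k : m ^** k `<=` [set x | (M ^** k) (phi x%:P)].
    elim: k => [//|k IH]; apply: (ideal_mul_min (contr _ (ideal_exp_ideal _ _))) => u v mu' /IH mv /=.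
    rewrite polyCM rmorphM; apply: mem_ideal_mul => //; exact: mem_ext.
  by move=> x /hexp mx; apply: (sub_ideal_addl (frobenius_ideal M (p ^ e)) mx).
apply: (frobenius_min (contr _ hb)) => x mx /=; rewrite rmorphXn rmorphXn.
apply: sub_ideal_addr; first exact: ideal_exp_ideal.
by apply: mem_frobenius; apply: mem_ext.
Qed.

(** * Asymptotics of box counts *)

Section BoxCount.
Local Open Scope nat_scope.

(* The number of points a of N^d with |a| < n. *)
Definition simplex_count d n := if n is n'.+1 then 'C(n' + d, d) else 0.

Lemma simplex_countS d n :
  simplex_count d.+1 n.+1 = simplex_count d.+1 n + simplex_count d n.+1.
Proof.
by case: n => [|n] /=; rewrite ?add0n ?binn // addnS binS -addSnnS.
Qed.

Lemma mul_simplex_count d n :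
  d.+1 * simplex_count d.+1 n = (n + d) * simplex_count d n.
Proof.
by case: n => [|n]; rewrite /= ?muln0 // addnS -mul_bin_diag addSn.
Qed.

Lemma box_count0 w n : box_count 0 w n = simplex_count 0 n.
Proof. by case: n => [|n]; rewrite /box_count //= bin0. Qed.

Lemma box_countS d w n : box_count d.+1 w n = \sum_(j < w) box_count d w (n - j).
Proof.
rewrite /box_count /= count_flatten -map_comp.
rewrite -(big_mkord xpredT (fun j => count (fun a => sumn a < n - j) (box d w))).
rewrite sumnE big_map /index_iota subn0; apply: eq_bigr => j _ /=.
by rewrite count_map; apply: eq_count => a /=; rewrite ltn_subRL.
Qed.

Lemma box_count_ge d w v n : v <= w -> d * v.-1 < n -> v ^ d <= box_count d w n.
Proof.
move=> vw hn; rewrite /box_count -size_filter -size_box.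
apply: uniq_leq_size; first exact: box_uniq.
move=> a ha; rewrite mem_filter (leq_ltn_trans (sumn_box ha)) //=.
move: ha; rewrite !mem_box => /andP[-> /allP h]; apply/allP => j /h hj.
exact: leq_trans vw.
Qed.

End BoxCount.

Lemma alternating_pascal (K : comNzRingType) d (g : nat -> K) :
  \sum_(i < d.+2) (-1) ^+ i * 'C(d.+1, i)%:R * g i =
  \sum_(i < d.+1) (-1) ^+ i * 'C(d, i)%:R * g i -
  \sum_(i < d.+1) (-1) ^+ i * 'C(d, i)%:R * g i.+1.
Proof.
rewrite big_ord_recl bin0.
have -> : \sum_(i < d.+1) (-1) ^+ i * 'C(d, i)%:R * g i =
  g 0%N + \sum_(i < d.+1) (-1) ^+ i.+1 * 'C(d, i.+1)%:R * g i.+1.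
  rewrite big_ord_recl bin0 expr0 !mul1r; congr (_ + _).
  by rewrite [RHS]big_ord_recr /= bin_small // mulr0 mul0r addr0.
rewrite expr0 !mul1r -addrA; congr (_ + _); rewrite -sumrB.
by apply: eq_bigr => i _; rewrite /bump /= ?add1n binS natrD exprS; ring.
Qed.

Section InclusionExclusion.
Variables (K : comNzRingType) (w : nat).

(** The number d of bounded coordinates is separated from the dimension k: F is the coefficient of
    t^n in t (1 - t^w)^d / (1 - t)^(k+1). [FS] and [windowF] express multiplication by 1 - t^w and
    by (1 - t^w)/(1 - t). Truncated subtraction is harmless since [simplex_count] vanishes at 0. *)
Let F d k n : K :=
  \sum_(i < d.+1) (-1) ^+ i * 'C(d, i)%:R * (simplex_count k (n - i * w))%:R.

Let FS d k n : F d.+1 k n = F d k n - F d k (n - w).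
Proof.
rewrite /F (alternating_pascal d (fun i => (simplex_count k (n - i * w))%:R)).
congr (_ - _); apply: eq_bigr => i _.
by rewrite mulSn subnDA.
Qed.

Let window k n :
  \sum_(j < w) (simplex_count k (n - j))%:R =
  (simplex_count k.+1 n)%:R - (simplex_count k.+1 (n - w))%:R :> K.
Proof.
elim: w => [|v IH]; first by rewrite big_ord0 subn0 subrr.
rewrite big_ord_recr /= IH subnS; case: (n - v)%N => [|l] /=; first by rewrite addr0.
by rewrite -[('C(l + k.+1, k.+1))]/(simplex_count k.+1 l.+1) simplex_countS natrD; ring.
Qed.

Let windowF d k n : \sum_(j < w) F d k (n - j) = F d k.+1 n - F d k.+1 (n - w).
Proof.
elim: d n => [|d IH] n.
  rewrite /F !big_ord_recl !big_ord0 /= !mul0n !subn0 !mul1r !addr0 -window.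
  by apply: eq_bigr => j _; rewrite big_ord_recl big_ord0 /= mul0n subn0 !mul1r addr0.
rewrite !FS -!IH -sumrB; apply: eq_bigr => j _.
by rewrite FS subnAC.
Qed.

Lemma box_count_inclusion_exclusion d n : (box_count d w n)%:R =
  \sum_(i < d.+1) (-1) ^+ i * 'C(d, i)%:R * (simplex_count d (n - i * w))%:R :> K.
Proof.
rewrite -/(F d d n); elim: d n => [|d IH] n.
  by rewrite box_count0 /F big_ord_recl big_ord0 mul0n subn0 !mul1r addr0.
rewrite box_countS natr_sum FS -windowF; apply: eq_bigr => j _; exact: IH.
Qed.

End InclusionExclusion.

Section Asymptotics.
Variables (K : realType) (p : nat).
Hypothesis p_gt1 : (1 < p)%N.
Implicit Types (s : K) (n : nat -> nat).

Let q e : K := p%:R ^+ e.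

Let q_gt0 e : 0 < q e.
Proof. by rewrite exprn_gt0 // ltr0n; apply: ltn_trans p_gt1. Qed.

Let q_neq0 e : q e != 0. Proof. by rewrite gt_eqF. Qed.

Lemma cvg_invX : (fun e => (q e)^-1) @ \oo --> (0 : K).
Proof.
have -> : (fun e => (q e)^-1) = (fun e => (p%:R^-1) ^+ e).
  by apply/funext => e; rewrite exprVn.
apply: cvg_expr; rewrite ger0_norm ?invr_ge0 // invf_lt1 ?ltr1n //.
by rewrite ltr0n; apply: ltn_trans p_gt1.
Qed.

(** Truncated subtraction as a positive part, in a form that is visibly continuous. *)
Lemma natr_subn (a b : nat) :
  (a - b)%:R = ((a%:R - b%:R) + `|a%:R - b%:R|) / 2 :> K.
Proof.
have [ab|ba] := leqP a b.
  have -> : (a - b = 0)%N by apply/eqP; rewrite subn_eq0.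
  by rewrite ler0_norm ?subr_le0 ?ler_nat // subrr mul0r.
rewrite natrB ?(ltnW ba) // ger0_norm ?subr_ge0 ?ler_nat ?(ltnW ba) //.
by field.
Qed.

Lemma cvg_subn n s i : (fun e => (n e)%:R / q e) @ \oo --> s ->
  (fun e => (n e - i * p ^ e)%:R / q e) @ \oo --> Num.max (s - i%:R) 0.
Proof.
move=> hn.
have -> : Num.max (s - i%:R) 0 = ((s - i%:R) + `|s - i%:R|) / 2.
  have [h|h] := leP (s - i%:R) 0; first by rewrite ler0_norm // subrr mul0r.
  by rewrite gtr0_norm //; field.
have -> : (fun e => (n e - i * p ^ e)%:R / q e) =
  (fun e => (((n e)%:R / q e - i%:R) + `|(n e)%:R / q e - i%:R|) / 2).
  apply/funext => e; rewrite natr_subn natrM natrX -/(q e).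
  have -> : (n e)%:R - i%:R * q e = ((n e)%:R / q e - i%:R) * q e.
    by field; exact: q_neq0.
  rewrite normrM (gtr0_norm (q_gt0 e)); field; exact: q_neq0.
have h1 : (fun e => (n e)%:R / q e - i%:R) @ \oo --> s - i%:R.
  by apply: cvgB => //; apply: cvg_cst.
apply: cvgM; last exact: cvg_cst.
by apply: cvgD => //; apply: cvg_norm.
Qed.

(** The dimension is positive because in dimension 0 the count only tells whether n vanishes, and
    this need not converge when s = 0, a value that [cvg_subn] produces. *)
Lemma cvg_simplex_count n s k : (fun e => (n e)%:R / q e) @ \oo --> s ->
  (fun e => (simplex_count k.+1 (n e))%:R / q e ^+ k.+1) @ \oo --> s ^+ k.+1 / (k.+1)`!%:R.
Proof.
move=> hn; elim: k => [|k IH].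
  have -> : s ^+ 1 / 1`!%:R = s by rewrite expr1 divr1.
  have -> : (fun e => (simplex_count 1 (n e))%:R / q e ^+ 1) =
    (fun e => (n e)%:R / q e) => //.
  by apply/funext => e; case: (n e) => [|l] //=; rewrite addn1 bin1.
have -> : (fun e => (simplex_count k.+2 (n e))%:R / q e ^+ k.+2) =
  (fun e => ((n e)%:R / q e + k.+1%:R * (q e)^-1) *
     ((simplex_count k.+1 (n e))%:R / q e ^+ k.+1) / k.+2%:R).
  apply/funext => e; have := mul_simplex_count k.+1 (n e).
  move=> /(congr1 (fun a => a%:R : K)); rewrite !natrM natrD => E.
  have k0 : k.+2%:R != 0 :> K by rewrite pnatr_eq0.
  apply: (mulfI k0); rewrite !mulrA E [q e ^+ k.+2]exprS.
  have := q_neq0 e; have : q e ^+ k.+1 != 0 by rewrite expf_neq0.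
  by move: (q e ^+ k.+1) => qk h1 h2; field; rewrite h1 h2 -natrD pnatr_eq0.
have -> : s ^+ k.+2 / (k.+2)`!%:R = (s + k.+1%:R * 0) * (s ^+ k.+1 / (k.+1)`!%:R) / k.+2%:R.
  rewrite mulr0 addr0 factS natrM invfM exprS; ring.
apply: cvgM; last exact: cvg_cst.
apply: cvgM IH; apply: cvgD => //; apply: cvgM; [exact: cvg_cst|exact: cvg_invX].
Qed.

(** Inclusion-exclusion runs up to the dimension, [H_s] up to the floor of s. Terms beyond the first
    bound vanish by the binomial coefficient, those beyond the second by the positive part. *)
Lemma H_s_max s d : 0 <= s ->
  \sum_(i < d.+2) (-1) ^+ i * 'C(d.+1, i)%:R *
     (Num.max (s - i%:R) 0 ^+ d.+1 / (d.+1)`!%:R) = H_s s d.+1.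
Proof.
move=> s0; pose G i := (-1) ^+ i * 'C(d.+1, i)%:R *
     (Num.max (s - i%:R) 0 ^+ d.+1 / (d.+1)`!%:R) : K.
rewrite -(big_mkord xpredT G) /H_s; set t := Num.truncn s.
have Gd i : (d.+1 < i)%N -> G i = 0 by move=> h; rewrite /G bin_small // mulr0 mul0r.
have Gt i : (t < i)%N -> G i = 0.
  move=> h; rewrite /G max_r ?expr0n ?mul0r ?mulr0 // subr_le0.
  by apply: le_trans (ltW (truncnS_gt s)) _; rewrite ler_nat.
pose N := maxn d.+2 t.+1.
have E k : (k <= N)%N -> (forall i, (k <= i)%N -> G i = 0) ->
    \sum_(0 <= i < k) G i = \sum_(0 <= i < N) G i.
  move=> kN h; rewrite (big_cat_nat (leq0n k) kN) /= [X in _ + X]big_nat_cond [X in _ + X]big1 ?addr0 //.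
  by move=> i /andP[/andP[/h]].
rewrite (E d.+2 _ Gd) ?leq_maxl // -(E t.+1 _ Gt) ?leq_maxr //.
rewrite [LHS]big_nat_cond [RHS]big_nat_cond; apply: eq_bigr => i /andP[/andP[_ it] _].
rewrite /G max_l; last first.
  rewrite subr_ge0; apply: le_trans (_ : t%:R <= _); first by rewrite ler_nat -ltnS.
  by have /andP[] := truncn_itv s0.
ring.
Qed.

Lemma cvg_sum_ord N (u : nat -> nat -> K) (l : nat -> K) :
  (forall i, u i @ \oo --> l i) ->
  (fun e => \sum_(i < N) u i e) @ \oo --> \sum_(i < N) l i.
Proof.
move=> h; elim: N => [|N IH].
  rewrite big_ord0 (_ : (fun e => _) = (fun=> 0)); first exact: cvg_cst.
  by apply/funext => e; rewrite big_ord0.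
rewrite big_ord_recr (_ : (fun e => _) = (fun e => \sum_(i < N) u i e + u N e)).
  by apply: cvgD.
by apply/funext => e; rewrite big_ord_recr.
Qed.

Lemma cvg_box_count n s d : 0 <= s -> (fun e => (n e)%:R / q e) @ \oo --> s ->
  (fun e => (box_count d.+1 (p ^ e) (n e))%:R / q e ^+ d.+1) @ \oo --> H_s s d.+1.
Proof.
move=> s0 hn; rewrite -(H_s_max d s0).
have -> : (fun e => (box_count d.+1 (p ^ e) (n e))%:R / q e ^+ d.+1) =
  (fun e => \sum_(i < d.+2) (-1) ^+ i * 'C(d.+1, i)%:R *
     ((simplex_count d.+1 (n e - i * p ^ e))%:R / q e ^+ d.+1)).
  apply/funext => e; rewrite box_count_inclusion_exclusion mulr_suml.
  by apply: eq_bigr => i _; rewrite !mulrA.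
apply: (@cvg_sum_ord _ (fun i e => (-1) ^+ i * 'C(d.+1, i)%:R *
     ((simplex_count d.+1 (n e - i * p ^ e))%:R / q e ^+ d.+1))
  (fun i => (-1) ^+ i * 'C(d.+1, i)%:R *
     (Num.max (s - i%:R) 0 ^+ d.+1 / (d.+1)`!%:R))) => i.
apply: cvgM; first exact: cvg_cst.
apply: (@cvg_simplex_count (fun e => (n e - i * p ^ e)%N)).
exact: cvg_subn.
Qed.

(** Squeezed between s - c/q and s + 1/q. *)
Lemma cvg_ceil s c : 0 < s ->
  (fun e => (absz (Num.ceil (s * q e)) - c)%:R / q e) @ \oo --> s.
Proof.
move=> s0.
have h0 : (fun e => s - c%:R * (q e)^-1) @ \oo --> s.
  rewrite -[X in _ --> X]subr0 -[X in _ - X](mulr0 c%:R).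
  apply: cvgB; first exact: cvg_cst.
  by apply: cvgM; [exact: cvg_cst|exact: cvg_invX].
have h1 : (fun e => s + (q e)^-1) @ \oo --> s.
  rewrite -[X in _ --> X]addr0; apply: cvgD; [exact: cvg_cst|exact: cvg_invX].
apply: (squeeze_cvgr _ h0 h1); near=> e.
have sq : 0 < s * q e by rewrite mulr_gt0.
set a := absz _.
have Ea : a%:R = (Num.ceil (s * q e))%:~R :> K.
  by rewrite -[a%:R]/((a%:Z)%:~R) /a gez0_abs // ceil_ge0 (lt_trans _ sq) // ltrN10.
have /andP[lo hi] := ceil_itv (s * q e).
rewrite intrB -Ea in lo; rewrite -Ea in hi.
rewrite ler_pdivlMr // ler_pdivrMr // mulrBl mulrDl mulVf // mulfVK //.
apply/andP; split.
  have [ca|ac] := leqP c a; first by rewrite natrB // lerB.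
  have : (a%:R : K) <= c%:R by rewrite ler_nat ltnW.
  have : (0 : K) <= (a - c)%:R by [].
  lra.
have : ((a - c)%:R : K) <= a%:R by rewrite ler_nat leq_subr.
lra.
Unshelve. all: by end_near. Qed.

(** Positivity is read off the limit of box counts: these dominate a cube of side q/p^t, where t is
    chosen so that its points have coordinate sum below s q / 2. *)
Lemma H_s_gt0 s d : 0 < s -> 0 < H_s s d.+1.
Proof.
move=> s0; pose n e := (absz (Num.ceil (s * q e)) - 0)%N.
have hn := cvg_ceil 0 s0.
have hc := @cvg_box_count n s d (ltW s0) hn.
have d0 : (0 : K) < 2 * d.+1%:R by rewrite mulr_gt0.
have [t ht] : exists t, (q t)^-1 <= s / (2 * d.+1%:R).
  have e0 : 0 < s / (2 * d.+1%:R) by rewrite divr_gt0.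
  have := @cvgr_lt _ _ _ _ _ _ cvg_invX _ e0.
  by move=> [N _ /(_ N (leqnn N)) h]; exists N; apply: ltW.
apply: (@lt_le_trans _ _ ((q t)^-1 ^+ d.+1)); first by rewrite exprn_gt0 // invr_gt0.
apply: (cvgr_to_ge hc).
have hs2 : s / 2 < s by rewrite ltr_pdivrMr // ltr_pMr // ltr1n.
near=> e.
have te : (t <= e)%N by near: e; exact: nbhs_infty_ge.
have hne : s / 2 < (n e)%:R / q e by near: e; apply: (cvgr_gt s hn).
have qd : 0 < q e ^+ d.+1 by rewrite exprn_gt0.
rewrite ler_pdivlMr // -exprMn.
have -> : (q t)^-1 * q e = (p ^ (e - t))%:R.
  by rewrite natrX /q -{1}(subnK te) exprD mulrC mulfK.
rewrite -natrX ler_nat; apply: box_count_ge; first by rewrite leq_pexp2l ?leq_subr // ltnW.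
rewrite -(ltr_nat K).
apply: (@le_lt_trans _ _ (d.+1%:R * (p ^ (e - t))%:R)).
  by rewrite -natrM ler_nat leq_mul2l leq_pred orbT.
have -> : (p ^ (e - t))%:R = (q t)^-1 * q e :> K.
  by rewrite natrX /q -{2}(subnK te) exprD mulrC mulfK.
move: hne; rewrite ltr_pdivlMr // => hne.
apply: le_lt_trans hne; rewrite mulrA ler_pM2r //.
move: ht; rewrite !ler_pdivlMr // => ht.
by have -> : d.+1%:R * (q t)^-1 * 2 = (q t)^-1 * (2 * d.+1%:R) by ring.
Unshelve. all: by end_near. Qed.

End Asymptotics.

(** * Idealization *)

Section IdealizationIdeals.
Variables (R : comNzRingType) (M : lmodType R).
Local Notation T := (idealization M).
Implicit Types (a P : set R) (Q : set T) (z w : T) (r : R) (x : M).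

Definition ideal_lift a : set T := [set z | a z.1].

Lemma ideal_lift_ideal a : is_ideal a -> is_ideal (ideal_lift a).
Proof.
move=> ha; apply/is_idealP; split; first exact: (ideal_0 ha).
by move=> u v w hv hw; apply: (ideal_D ha) => //; apply: (ideal_Ml ha).
Qed.

Lemma ideal_lift_prime P : is_prime_ideal P -> is_prime_ideal (ideal_lift P).
Proof.
move=> /is_prime_idealP[hP P1 PM]; apply/is_prime_idealP; split=> //.
  exact: ideal_lift_ideal.
by move=> u v; apply: PM.
Qed.

Lemma ideal_lift_proper_sub a b : a `<` b -> ideal_lift a `<` ideal_lift b.
Proof.
move=> [ab nba]; split; first by move=> z; apply: ab.
by move=> h; apply: nba => r br; apply: (h (r, 0)).
Qed.

Definition ideal_contract Q : set R := [set r | Q ((r, 0) : T)].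

Lemma ideal_contract_ideal Q : is_ideal Q -> is_ideal (ideal_contract Q).
Proof.
move=> hQ; apply/is_idealP; split; first exact: (ideal_0 hQ).
move=> r s t Qs Qt; rewrite /ideal_contract /=.
have -> : ((r * s + t, 0) : T) = ((r, 0) : T) * ((s, 0) : T) + ((t, 0) : T).
  by congr pair; rewrite /= !scaler0 !addr0.
by apply: (ideal_D hQ) => //; apply: (ideal_Ml hQ).
Qed.

(* The ideal 0 |x M squares to zero, so it lies in every prime ideal. *)
Lemma prime_ideal_contractE Q z : is_prime_ideal Q -> Q z <-> ideal_contract Q z.1.
Proof.
move=> /is_prime_idealP[hQ _ QM]; case: z => r x; rewrite /ideal_contract /=.
have Qx : Q ((0, x) : T).
  suff /QM[] : Q (((0, x) : T) * ((0, x) : T)) by [].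
  have -> : ((0, x) : T) * ((0, x) : T) = 0.
    by congr pair; rewrite /= ?mul0r // scale0r addr0.
  exact: (ideal_0 hQ).
have E : ((r, x) : T) = ((r, 0) : T) + ((0, x) : T).
  by congr pair; rewrite /= ?addr0 ?add0r.
rewrite E; split=> h; last exact: (ideal_D hQ).
exact: (ideal_Dl hQ h).
Qed.

Lemma ideal_contract_prime Q : is_prime_ideal Q -> is_prime_ideal (ideal_contract Q).
Proof.
move=> pQ; have /is_prime_idealP[hQ Q1 QM] := pQ; apply/is_prime_idealP; split=> //.
  exact: ideal_contract_ideal.
move=> r s /(prime_ideal_contractE (((r, 0) : T) * ((s, 0) : T)) pQ)/QM.
by case; [left|right].
Qed.

Lemma ideal_contract_proper_sub (P Q : set T) : is_prime_ideal P -> is_prime_ideal Q ->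
  P `<` Q -> ideal_contract P `<` ideal_contract Q.
Proof.
move=> pP pQ [PQ nQP]; split; first by move=> r; apply: PQ.
by move=> h; apply: nQP => z /(prime_ideal_contractE z pQ)/h/(prime_ideal_contractE z pP).
Qed.

(** Lifting and contracting primes both preserve strict inclusions, so the same chain lengths
    occur. *)
Lemma krull_dim_idealization : krull_dim T = krull_dim R.
Proof.
rewrite /krull_dim; congr nat_max; apply/seteqP; split=> n [c [c1 c2]].
  exists (ideal_contract \o c); split=> i hi; first exact/ideal_contract_prime/c1.
  by apply: ideal_contract_proper_sub (c2 _ hi); apply: c1 => //; apply: ltnW.
exists (ideal_lift \o c); split=> i hi; first exact/ideal_lift_prime/c1.
exact/ideal_lift_proper_sub/c2.
Qed.

Lemma ideal_exp_ideal_lift (I : set T) a n : I `<=` ideal_lift a -> I ^** n `<=` ideal_lift (a ^** n).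
Proof.
move=> h; elim: n => // n IH; apply: ideal_mul_min; first exact/ideal_lift_ideal/ideal_exp_ideal.
by move=> u v /h Iu /IH Iv; apply: mem_ideal_mul.
Qed.

Lemma frobenius_ideal_lift (I : set T) a q : I `<=` ideal_lift a ->
  frobenius_power I q `<=` ideal_lift (frobenius_power a q).
Proof.
move=> h; apply: frobenius_min; first exact/ideal_lift_ideal/frobenius_ideal.
move=> z /h az; have E k : (z ^+ k).1 = z.1 ^+ k.
  by elim: k => // k IH; rewrite !exprS -IH.
by rewrite /ideal_lift /= E; apply: mem_frobenius.
Qed.

(** Pulling a chain back along the projection onto R keeps it strict. *)
Lemma quot_length_ideal_lift (K : realType) (I : set T) a k :
  is_ideal a -> I `<=` ideal_lift a -> ideal_chain a setT k ->
  (k%:R%:E <= @quot_length T T^o K (@submod_mul T T^o I setT))%E.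
Proof.
move=> ha Ia [c [c1 c2]]; apply: ereal_sup_ubound; exists k => //.
exists (ideal_lift \o c); split=> i hi; last exact/ideal_lift_proper_sub/c2.
have [hc ac _] := c1 _ hi; split; first exact: ideal_lift_ideal.
apply: ideal_mul_min; first exact: ideal_lift_ideal.
move=> u v /Ia au _; apply: (ideal_Mr (ideal_lift_ideal hc)); exact: ac.
Qed.

End IdealizationIdeals.

Theorem theorem1p1 (K : realType) (R : comNzRingType) (m : set R)
    (M : lmodType R) (p : nat) (s : K)
    (R_noetherian : noetherian R) (R_local : is_local m)
    (R_CM : cohen_macaulay m) (R_char : p \in [pchar R])
    (dim_gt0 : (0 < krull_dim R)%N)
    (M_fg : finitely_generated [set: M]) (s_gt0 : 0 < s) :
  forall c : K,
    is_s_multiplicity p s (idealization_set m (submod_mul m [set: M])) c ->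
    1 <= c.
Proof.
move=> _ [h hlim ->]; have p_gt1 := prime_gt1 (pcharf_prime R_char).
rewrite /is_h_s krull_dim_idealization in hlim *.
have [c0 hlen] := length_lower_bound R_noetherian R_local R_CM R_char dim_gt0.
case: (krull_dim R) dim_gt0 hlim hlen => // d _ hlim hlen.
have H0 : 0 < H_s s d.+1 by apply: (H_s_gt0 p_gt1).
rewrite ler_pdivlMr // mul1r.
(* The shift by [c0] is bounded, so the counts divided by q^d still tend to [H_s]. *)
pose n e := (absz (Num.ceil (s * p%:R ^+ e)) - c0)%N.
have hcnt := @cvg_box_count K p p_gt1 n s d (ltW s_gt0) (cvg_ceil p_gt1 c0 s_gt0).
have hcntE : (fun e => ((box_count d.+1 (p ^ e) (n e))%:R / (p%:R ^+ e) ^+ d.+1)%:E : \bar K)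
    @ \oo --> (H_s s d.+1)%:E by apply: cvg_EFin => //; apply: nearW.
(* The bound on h is a comparison of limits in the extended reals, where the lengths take their
   values. *)
rewrite -lee_fin -(cvg_lim _ hlim) // -(cvg_lim _ hcntE) //.
apply: lee_lim; [by apply/cvg_ex; eexists; exact: hcntE|by apply/cvg_ex; eexists; exact: hlim|].
apply: nearW => e; rewrite EFinM exprM; apply: lee_wpmul2r.
  by rewrite lee_fin invr_ge0 exprn_ge0 // exprn_ge0.
apply: quot_length_ideal_lift (hlen e _).
  by apply: ideal_add_ideal; [apply: ideal_exp_ideal|apply: frobenius_ideal].
have mm : idealization_set m (submod_mul m [set: M]) `<=` ideal_lift m by move=> z [].
apply: ideal_add_min; first exact/ideal_lift_ideal/ideal_add_ideal/frobenius_ideal/ideal_exp_ideal.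
  apply: subset_trans (ideal_exp_ideal_lift mm) _ => z hz.
  exact: (sub_ideal_addl (frobenius_ideal m (p ^ e)) (hz : (m ^** _) z.1)).
apply: subset_trans (frobenius_ideal_lift mm) _ => z hz.
exact: (sub_ideal_addr (ideal_exp_ideal m _) (hz : frobenius_power m _ z.1)).
Qed.
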